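(* Let $f,h,A,\mathcal{L},\mathscr{L},\alpha,L,M$ be as in the context, assume conditions (A1)–(A4) of the context, and let $\{(x^k,y^k)\}_{k\ge 0}$ be a sequence generated by the PPDG iteration with stepsize $\alpha>0$ and $M=\alpha AA^T$, where $\alpha$ and $\delta>0$ are such that the constants $a,b,c$ of the context are positive. Suppose that $\{(x^k,y^k)\}$ is bounded and that $\mathscr{L}$ is a KL function with Łojasiewicz exponent $\theta\in[0,1)$. Let $(\bar x,\bar y)$ be the limit of $(x^k,y^k)$, and let $\hat\lambda:=\sqrt{\lambda_{\min}(AA^T)}$, where $\lambda_{\min}(AA^T)$ is the smallest eigenvalue of $AA^T$. Then: (i) if $\theta=0$, the sequence $\{(x^k,y^k)\}$ converges in finitely many steps; (ii) if $\theta\in(0,\frac12]$, there exist constants $\nu>0$, $0<\tau<1$ and a positive integer $K$ such that for all $k\ge K$, $$\|x^k-\bar x\|\le\nu\tau^{k-K},\qquad \|y^k-\bar y\|\le\nu'\tau^{k-K},\qquad \nu':=\nu(1/\alpha+L)/\hat\lambda;$$ (iii) if $\theta\in(\frac12,1)$, there exist a constant $\mu>0$ and a positive integer $\bar K$ such that for all $k\ge\bar K$, $$\|x^k-\bar x\|\le\mu k^{-\frac{1-\theta}{2\theta-1}},\qquad \|y^k-\bar y\|\le\mu' k^{-\frac{1-\theta}{2\theta-1}},\qquad \mu':=\mu(1/\alpha+L)/\hat\lambda.$$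
   Context: Setting. $\mathbb{X},\mathbb{Y}$ are finite-dimensional real inner product spaces with duals $\mathbb{X}^*,\mathbb{Y}^*$ (identified with $\mathbb{X},\mathbb{Y}$ via the inner products); $f:\mathbb{X}\to\mathbb{R}$ is continuously differentiable (possibly nonconvex), $A:\mathbb{X}\to\mathbb{Y}$ is linear with adjoint $A^T$, and $h:\mathbb{Y}\to(-\infty,+\infty]$ is possibly nonsmooth and nonconvex. The conjugate is $h^*(y)=\sup_{u\in\mathbb{Y}}\{\langle y,u\rangle-h(u)\}$, a convex lower semicontinuous function with convex subdifferential $\partial h^*$. Define $\mathcal{L}(x,y):=f(x)+\langle y,Ax\rangle-h^*(y)$ on $\mathbb{X}\times\mathbb{Y}^*$. Assumptions. (A1) there is $L>0$ with $\|\nabla f(x)-\nabla f(z)\|\le L\|x-z\|$ for all $x,z\in\mathbb{X}$. (A2) $\inf_{x\in\mathbb{X}}\mathcal{L}(x,y)>-\infty$ for every $y\in\mathbb{Y}^*$. (A3) $A$ is surjective. (A4) the convex hull of the function $h$ is proper. PPDG iteration. Given $(x^0,y^0)\in\mathbb{X}\times\mathbb{Y}^*$, $\alpha>0$ and $M=\alpha AA^T$ (positive definite), for $k\ge0$: $x^{k+1}=x^k-\alpha(\nabla f(x^k)+A^Ty^k)$, and $y^{k+1}=\mathrm{prox}^{M}_{h^*}\big(y^k+M^{-1}A(2x^{k+1}-x^k)\big)$, where $\mathrm{prox}^M_{h^*}(w)=\arg\min_{y}\{h^*(y)+\tfrac12\langle M(y-w),y-w\rangle\}$. Constants and Lyapunov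 function. For $\delta>0$: $a:=\frac{\delta}{\alpha}$, $b:=\frac{1}{2\alpha}-\frac{L}{4}-\frac{\delta}{\alpha}-\frac{\alpha\delta L^2}{2}-\delta L+\frac{\alpha L^2}{4\delta}$, $c:=b-\frac{\alpha L^2}{2\delta}$. Define $\mathscr{L}(x,y,u,v):=\mathcal{L}(x,y)-a\|x-u\|^2+b\|x-v\|^2$ for $x,u,v\in\mathbb{X}$, $y\in\mathbb{Y}^*$, and $\partial\mathscr{L}(x,y,u,v):=\{\nabla f(x)+A^Ty-2a(x-u)+2b(x-v)\}\times(Ax-\partial h^*(y))\times\{2a(x-u)\}\times\{2b(v-x)\}$. KL functions. A function $\Phi$ with subdifferential $\partial\Phi$ (for $\Phi=\mathscr{L}$ the one just defined) has the KL property at $\bar z\in\mathrm{dom}\,\partial\Phi:=\{z:\partial\Phi(z)\ne\emptyset\}$ if there exist $\eta\in(0,+\infty]$, a neighborhood $U$ of $\bar z$ and a continuous concave $\varphi:[0,\eta)\to[0,+\infty)$ with $\varphi(0)=0$, $\varphi$ continuously differentiable with $\varphi'>0$ on $(0,\eta)$, such that $\varphi'(\Phi(z)-\Phi(\bar z))\cdot\mathrm{dist}(0,\partial\Phi(z))\ge1$ for all $z\in U$ with $0<\Phi(z)-\Phi(\bar z)<\eta$. $\Phi$ is a KL function with Łojasiewicz exponent $\theta\in[0,1)$ if at every point of $\mathrm{dom}\,\partial\Phi$ this holds with $\varphi(s)=\sigma s^{1-\theta}$ for some $\sigma>0$. Under the hypotheses of the claim the sequence $(x^k,y^k)$ is convergent.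 ''Converges in finitely many steps'' means $(x^k,y^k)=(\bar x,\bar y)$ for all sufficiently large $k$. *)

(* Defs.v *)
From HB Require Import structures.
From mathcomp Require Import all_boot all_order all_algebra.
From mathcomp Require Import all_classical all_reals all_analysis.
Set Implicit Arguments.
Unset Strict Implicit.
Unset Printing Implicit Defensive.
Import Order.TTheory GRing.Theory Num.Theory.
Import numFieldNormedType.Exports.
Local Open Scope classical_set_scope.
Local Open Scope ring_scope.

(* Finite-dimensional real inner product spaces, with the norm induced by the
   inner product. Positive definiteness of [inner] follows from [inner_norm].
   Dual spaces are identified with the spaces themselves. *)
HB.mixin Record NormedVector_isInner (R : realType) V
    of Vector R V & NormedModule R V := {
  inner : V -> V -> R ;
  innerC : forall u v, inner u v = inner v u ;
  innerDl : forall u v w, inner (u + v) w = inner u w + inner v w ;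
  innerZl : forall (a : R) u v, inner (a *: u) v = a * inner u v ;
  inner_norm : forall u, inner u u = `|u| ^+ 2
}.

#[short(type="euclidType")]
HB.structure Definition Euclid (R : realType) :=
  { V of Vector R V & NormedModule R V & NormedVector_isInner R V }.

Definition convex_hull (R : realType) (E : lmodType R) (S : set E) : set E :=
  smallest (@convex_set R E) S.

Section ConvexAnalysis.
Context (R : realType) (V : euclidType R).
Implicit Types (g : V -> \bar R) (y : V).
Local Open Scope ereal_scope.

Definition proper_fun g := (exists y, g y < +oo) /\ (forall y, -oo < g y).

(* The greatest convex function majorized by [g]: the lower envelope of the
   convex hull of the epigraph of [g]. *)
Definition epigraph g : set (V * R^o)%type := [set yr | g yr.1 <= yr.2%:E].

Definition convex_hull_fun g y : \bar R :=
  ereal_inf [set r%:E | r in [set r : R |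
    convex_hull (epigraph g) (y, r)]].

Definition conjugate g y : \bar R :=
  ereal_sup [set (inner y u)%:E - g u | u in [set: V]].

Definition subdiff g y : set V :=
  [set p | g y \is a fin_num /\
           forall w, g y + (inner p (w - y))%:E <= g w].

(* The minimizers of [+oo] are, by convention, none. *)
Definition argmin g : set V :=
  [set y | g y < +oo /\ forall w, g y <= g w].

Definition prox (M : 'End(V)) g (w : V) : set V :=
  argmin (fun y => g y + (2^-1 * inner (M (y - w)%R) (y - w)%R)%:E).

End ConvexAnalysis.

Section Calculus.
Context (R : realType) (X Y : euclidType R).

(* [f] is continuously differentiable with gradient [gradf]. *)
Definition is_C1_gradient (f : X -> R) (gradf : X -> X) :=
  (forall x, differentiable f x /\ forall v, 'd f x v = inner (gradf x) v) /\
  continuous gradf.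

Definition is_adjoint (A : 'Hom(X, Y)) (AT : 'Hom(Y, X)) :=
  forall x y, inner y (A x) = inner (AT y) x.

Definition is_min_eigenvalue (B : 'End(Y)) (lambda : R) :=
  passmx.leigenvalue B lambda /\ forall mu, passmx.leigenvalue B mu -> lambda <= mu.

End Calculus.

Section KL.
Context (R : realType) (Z : topologicalType).
(* [nrm] is the norm used to measure the elements of the subdifferential
   [dPhi]; an empty subdifferential is at distance [+oo] from 0. *)
Variables (nrm : Z -> R) (Phi : Z -> \bar R) (dPhi : Z -> set Z).
Local Open Scope ereal_scope.

Definition dom_sub : set Z := [set z | dPhi z !=set0].

Definition dist0 (S : set Z) : \bar R := ereal_inf [set (nrm w)%:E | w in S].

Definition desingularizing (eta : \bar R) (phi : R -> R) :=
  let D := [set s : R | (0 <= s)%R /\ s%:E < eta] in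
  [/\ phi 0%R = 0%R,
      (forall s, D s -> (0 <= phi s)%R),
      {within D, continuous phi},
      (forall s t l : R, D s -> D t -> (0 <= l <= 1)%R ->
         (l * phi s + (1 - l) * phi t <= phi (l * s + (1 - l) * t))%R) &
      (forall s : R, (0 < s)%R -> s%:E < eta ->
         [/\ derivable phi s 1%R, {for s, continuous phi^`()%classic} &
             (0 < phi^`()%classic s)%R])].

(* The KL property at [zbar] with desingularizing function [phi]. *)
Definition KL_at (zbar : Z) (phi : R -> R) :=
  exists (eta : \bar R) (U : set Z),
    [/\ 0 < eta, nbhs zbar U, desingularizing eta phi &
        forall z, U z -> 0 < Phi z - Phi zbar < eta ->
          1 <= (phi^`()%classic (fine (Phi z - Phi zbar)))%:E
                 * dist0 (dPhi z)].

Definition KL_exponent (theta : R) :=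
  forall zbar, dom_sub zbar ->
    exists2 sigma : R, (0 < sigma)%R &
      KL_at zbar (fun s => sigma * s `^ (1 - theta))%R.

End KL.

Section PPDG.
Context (R : realType) (X Y : euclidType R).
Variables (f : X -> R) (gradf : X -> X) (h : Y -> \bar R).
Variables (A : 'Hom(X, Y)) (AT : 'Hom(Y, X)).

Definition Lagrangian (x : X) (y : Y) : \bar R :=
  ((f x + inner y (A x))%:E - conjugate h y)%E.

Definition PPDG (alpha : R) (x : nat -> X) (y : nat -> Y) :=
  let M : 'End(Y) := alpha *: (A \o AT)%VF in
  forall k,
    x k.+1 = x k - alpha *: (gradf (x k) + AT (y k)) /\
    prox M (conjugate h)
      (y k + (M^-1)%VF (A (2 *: x k.+1 - x k))) (y k.+1).

Definition const_a (alpha delta : R) : R := delta / alpha.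

Definition const_b (L alpha delta : R) : R :=
  (2 * alpha)^-1 - L / 4 - delta / alpha - alpha * delta * L ^+ 2 / 2
  - delta * L + alpha * L ^+ 2 / (4 * delta).

Definition const_c (L alpha delta : R) : R :=
  const_b L alpha delta - alpha * L ^+ 2 / (2 * delta).

Local Notation Z := (X * Y * X * X)%type.

(* The norm of the product inner product space, as opposed to the library's
   (equivalent) maximum norm on products. *)
Definition prod_norm (z : Z) : R :=
  let: (x, y, u, v) := z in
  Num.sqrt (`|x| ^+ 2 + `|y| ^+ 2 + `|u| ^+ 2 + `|v| ^+ 2).

Definition Lyapunov (a b : R) (z : Z) : \bar R :=
  let: (x, y, u, v) := z in
  (Lagrangian x y - (a * `|x - u| ^+ 2)%:E + (b * `|x - v| ^+ 2)%:E)%E.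

Definition Lyapunov_sub (a b : R) (z : Z) : set Z :=
  let: (x, y, u, v) := z in
  [set gradf x + AT y - (2 * a) *: (x - u) + (2 * b) *: (x - v)]
    `*` [set A x - p | p in subdiff (conjugate h) y]
    `*` [set (2 * a) *: (x - u)]
    `*` [set (2 * b) *: (v - x)].

End PPDG.

(* Main.v *)
(* The energy is the Lyapunov function evaluated at
   (x^(n+1), y^(n+1), x^(n+2), x^n).  The optimality condition of the proximal
   step gives the subgradient
     p = A (x^(n+2) + alpha (grad f x^(n+1) - grad f x^n))  of h^* at y^(n+1),
   in which y no longer appears.  Hence the energy decreases by a multiple of
   e_n^2, where e_n = |x^(n+1) - x^n| + |x^(n+2) - x^(n+1)|, while its
   subdifferential contains an element of norm O(e_n) at the same index.  The
   Kurdyka-Lojasiewicz inequality at one cluster point thus bounds e_n by the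
   decrease of a multiple of r_n^(1 - theta), r_n being the energy gap; this
   traps the iterates near the cluster point and bounds |x^(n+1) - xbar| by
   r_n^(1 - theta).  It also gives r_n - r_(n+1) >= kappa r_n^(2 theta), from
   which the three rates follow.  The errors of y are controlled by those of x
   through A^T y^n = - grad f x^n - (x^(n+1) - x^n) / alpha and
   |A^T w| >= sqrt (lambda_min) |w|. *)
Require Import Defs.
From HB Require Import structures.
From mathcomp Require Import all_boot all_order all_algebra.
From mathcomp Require Import all_classical all_reals all_analysis.
From mathcomp Require Import ring lra.
Import Order.TTheory GRing.Theory Num.Theory.
Import numFieldNormedType.Exports.
Local Open Scope classical_set_scope.
Local Open Scope ring_scope.

(** * Real inequalities and decay rates *)

Section RealInequalities.
Context {R : realType}.
Implicit Types (u s t p : R).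

Lemma ler_cvg_seq {v w : nat -> R} {l m : R} :
  v @ \oo --> l -> w @ \oo --> m -> (forall n, v n <= w n) -> l <= m.
Proof.
move=> vl wm H; rewrite -subr_ge0; apply: (cvgr_to_ge (cvgB wm vl)).
by near=> n; rewrite /= subr_ge0.
Unshelve. all: by end_near. Qed.

(** First-order stationarity at t = 0, later applied to the Rayleigh quotient. A small negative t
    makes the linear term win. *)
Lemma ge0_quadratic_linear_coef {s q : R} : 0 <= s ->
  (forall t, 0 <= 2 * t * s + t ^+ 2 * q) -> s = 0.
Proof.
move=> s0 H; apply/eqP; rewrite eq_le s0 andbT leNgt; apply/negP => sP.
have Q0 : 0 < `|q| + 1 by rewrite ltr_wpDl.
have := H (- (s / (`|q| + 1))).
have -> : 2 * - (s / (`|q| + 1)) * s + (- (s / (`|q| + 1))) ^+ 2 * q =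
  (s / (`|q| + 1)) ^+ 2 * (q - 2 * (`|q| + 1)) by field; rewrite gt_eqF.
rewrite pmulr_rge0 ?exprn_gt0 ?divr_gt0//.
by have := ler_norm q; have := normr_ge0 q; lra.
Qed.

(** Replaces letting t tend to 0 after dividing a first-order condition by t: one explicit small t
    suffices. *)
Lemma ge0_of_affine_ge0 {s q : R} : (forall t, 0 < t <= 1 -> 0 <= s + t * q) -> 0 <= s.
Proof.
move=> H; rewrite leNgt; apply/negP => s0.
have Q0 : 0 < `|q| + 1 - s by have := normr_ge0 q; lra.
have := H (- s / (`|q| + 1 - s)).
have -> : 0 < - s / (`|q| + 1 - s) <= 1.
  by rewrite divr_gt0 ?oppr_gt0// ler_pdivrMr// mul1r; have := normr_ge0 q; lra.
have -> : s + - s / (`|q| + 1 - s) * q = s / (`|q| + 1 - s) * (`|q| - q + 1 - s).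
  by field; rewrite gt_eqF.
move=> /(_ isT); rewrite nmulr_rge0; last by rewrite pmulr_llt0 ?invr_gt0.
by have := ler_norm q; lra.
Qed.

(** Young's inequality for the product of [u ^ p] and 1, with exponents 1/p and 1/(1 - p). *)
Lemma powR_le_tangent1 {u p} : 0 <= u -> 0 <= p <= 1 -> u `^ p <= 1 + p * (u - 1).
Proof.
move=> u0 /andP[]; rewrite le_eqVlt => /predU1P[<-|p0].
  by rewrite powRr0 mul0r addr0.
rewrite le_eqVlt => /predU1P[->|p1]; first by rewrite powRr1 //; lra.
have p'0 : 0 < 1 - p by rewrite subr_gt0.
have := @conjugate_powR R (u `^ p) 1 p^-1 (1 - p)^-1 (powR_ge0 _ _) ler01.
rewrite !invr_gt0 p0 p'0 !invrK => /(_ isT isT); rewrite addrCA subrr addr0.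
move=> /(_ erefl); rewrite mulr1 powR1 -powRrM divff ?gt_eqF// powRr1//.
by lra.
Qed.

(** By homogeneity this is the tangent inequality at 1, taken at t / s. *)
Lemma powR_sub_ge_tangent {s t p} : 0 < s -> 0 <= t -> 0 <= p <= 1 ->
  p * s `^ (p - 1) * (s - t) <= s `^ p - t `^ p.
Proof.
move=> s0 t0 p01.
have sN0 : s != 0 by rewrite gt_eqF.
have tE : t `^ p = s `^ p * (t / s) `^ p.
  by rewrite -powRM ?divr_ge0 ?(ltW s0)// [s * _]mulrC divfK.
have sE : s `^ (p - 1) = s `^ p / s by rewrite powRB ?powRr1 ?(ltW s0)// sN0 implybT.
have := powR_le_tangent1 (divr_ge0 t0 (ltW s0)) p01.
move=> /(ler_wpM2l (powR_ge0 s p)); rewrite -tE sE => H.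
have -> : p * (s `^ p / s) * (s - t) = s `^ p - s `^ p * (1 + p * (t / s - 1)).
  by field.
by lra.
Qed.

Lemma powR_cvg_to0 {v : nat -> R} {p} : 0 < p -> (forall n, 0 <= v n) ->
  v @ \oo --> 0 -> (v n `^ p) @[n --> \oo] --> 0.
Proof.
move=> p0 v0 vl; apply/cvgr0Pnorm_le => e e0.
have e'0 : 0 < e `^ p^-1 by rewrite powR_gt0.
have /cvgr0Pnorm_le/(_ _ e'0) := vl; apply: filterS => n.
rewrite !ger0_norm ?powR_ge0// => H.
rewrite -[leRHS](powRr1 (ltW e0)) -(mulVf (lt0r_neq0 p0)) powRrM.
by apply: ge0_ler_powR => //; rewrite ?nnegrE ?powR_ge0// ltW.
Qed.

Lemma powR_exprn {u p} m : 0 <= u -> (u ^+ m) `^ p = (u `^ p) ^+ m.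
Proof.
move=> u0; elim: m => [|m IH]; first by rewrite !expr0 powR1.
by rewrite !exprS powRM ?exprn_ge0// IH.
Qed.

Lemma geometric_decay {r : nat -> R} {q N} : 0 <= q ->
  (forall n, (N <= n)%N -> r n.+1 <= q * r n) ->
  forall m, r (N + m)%N <= r N * q ^+ m.
Proof.
move=> q0 H; elim=> [|m IH]; first by rewrite addn0 expr0 mulr1.
rewrite addnS; apply: (le_trans (H _ (leq_addr _ _))).
by rewrite exprS mulrCA ler_wpM2l.
Qed.

(* The recursion makes [r n `^ (- p)] grow by at least [p * kappa] at each
   step. *)
Lemma sublinear_decay {r : nat -> R} {kappa p N} : 0 <= kappa -> 0 < p <= 1 ->
  (forall n, 0 <= r n) ->
  (forall n, (N <= n)%N -> kappa * r n `^ (1 + p) <= r n - r n.+1) ->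
  forall m, r (N + m)%N `^ p * (p * kappa * m%:R) <= 1.
Proof.
move=> k0 /andP[p0 p1] r0 H; elim=> [|m IH]; first by rewrite !mulr0 ler01.
rewrite addnS; set s := r (N + m)%N in IH *.
have {}H := H _ (leq_addr m N); rewrite -/s in H.
have rS0 := r0 (N + m).+1; have s0 : 0 <= s := r0 _.
have [s_eq0|sN0] := eqVneq s 0.
  have -> : r (N + m).+1 = 0.
    apply/le_anti; rewrite rS0 andbT.
    by have := mulr_ge0 k0 (powR_ge0 s (1 + p)); lra.
  by rewrite powR0 ?gt_eqF// mul0r ler01.
have sP : 0 < s by rewrite lt_def sN0.
set a := s `^ p in IH.
have a0 : 0 <= a by exact: powR_ge0.
have sE : s `^ (1 + p) = s * a.
  by rewrite powRD ?powRr1// sN0 implybT.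
rewrite sE in H.
have ka1 : kappa * a <= 1 by rewrite -(ler_pM2l sP) mulr1; nra.
have ka0 : 0 <= kappa * a by rewrite mulr_ge0.
(* The recursion reads r' <= s (1 - kappa a); raise it to the power p and apply the tangent
   inequality to the factor. *)
have le1 : r (N + m).+1 `^ p <= a * (1 - p * (kappa * a)).
  have : r (N + m).+1 <= s * (1 - kappa * a) by nra.
  move=> /(ge0_ler_powR (ltW p0)); rewrite !nnegrE => /(_ rS0).
  have ? : 0 <= 1 - kappa * a by lra.
  rewrite mulr_ge0// => /(_ isT)/le_trans; apply.
  rewrite powRM// -/a ler_wpM2l//.
  have -> : 1 - p * (kappa * a) = 1 + p * (1 - kappa * a - 1) by ring.
  by apply: powR_le_tangent1 => //; rewrite p1 ltW.
have B0 : 0 <= p * kappa * m.+1%:R by rewrite !mulr_ge0// ltW.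
apply: (le_trans (ler_wpM2r B0 le1)).
rewrite -natr1; set b := a * _ in IH; set t := p * (kappa * a).
have t0 : 0 <= t by rewrite mulr_ge0// ltW.
have t1 : t <= 1 by rewrite /t; nra.
(* With b <= 1 by induction, (b + t)(1 - t) <= 1 - t^2 <= 1. *)
have -> : a * (1 - t) * (p * kappa * (m%:R + 1)) = b * (1 - t) + t * (1 - t).
  by rewrite /b /t; ring.
by nra.
Qed.

Lemma derive1_scaled_powR (sigma p s : R) : 0 < s ->
  ((fun s => sigma * s `^ p)^`())%classic s = sigma * p * s `^ (p - 1).
Proof.
move=> s0; rewrite derive1E; have H := is_derive1_powR p s0.
have := @is_deriveZ _ _ _ _ sigma _ _ _ H.
by case=> _ /= E; rewrite -mulrA; exact: E.
Qed.

End RealInequalities.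

(** * Three decay regimes of the scalar recursion *)

Section Rates.
Context {R : realType} {r : nat -> R} {theta kappa : R} {N : nat}.
Hypothesis r_ge0 : forall n, 0 <= r n.
Hypothesis r_dec : nonincreasing_seq r.
Hypothesis r_cvg : r @ \oo --> 0.
Hypothesis kappa_gt0 : 0 < kappa.
Hypothesis r_rec : forall n, (N <= n)%N -> 0 < r n ->
  kappa * r n `^ (2 * theta) <= r n - r n.+1.

(** A positive gap would lose at least [kappa] in one step, which is impossible once the gap is
    below [kappa]. *)
Lemma finite_decay : theta = 0 -> exists K, forall n, (K <= n)%N -> r n = 0.
Proof.
move=> th0; have [N1 _ HN1] := (cvgr0Pnorm_lt _).1 r_cvg _ kappa_gt0.
pose K := maxn N N1; suff rK : r K = 0.
  by exists K => n Kn; apply/le_anti; rewrite r_ge0 -rK r_dec.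
apply: contrapT => /eqP rN0; have rP : 0 < r K by rewrite lt_def rN0 r_ge0.
have := r_rec _ (leq_maxl N N1) rP; rewrite th0 mulr0 powRr0 mulr1.
have := HN1 K (leq_maxr N N1); rewrite ger0_norm// -/K.
by have := r_ge0 K.+1; lra.
Qed.

(** Once r < 1, the exponent 2 theta <= 1 gives r <= r^(2 theta), so the recursion contracts by 1 -
    kappa. *)
Lemma linear_decay : 0 < theta <= 2^-1 -> exists (q : R) (K : nat),
  [/\ 0 < q < 1, (N <= K)%N & forall m, r (K + m)%N <= r K * q ^+ m].
Proof.
move=> /andP[th0 th1].
have [N1 _ HN1] := (cvgr0Pnorm_lt _).1 r_cvg _ ltr01.
(* The maximum with 1/2 keeps [q] positive even if kappa >= 1. *)
pose q := Num.max (1 - kappa) 2^-1; pose K := maxn N N1.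
have q1 : 1 - kappa <= q by rewrite le_max lexx.
have q2 : 2^-1 <= q by rewrite le_max lexx orbT.
have q0 : 0 < q by apply: lt_le_trans q2; rewrite invr_gt0.
exists q, K; split; [|exact: leq_maxl|].
  rewrite q0/= gt_max; apply/andP; split; first by rewrite ltrBlDr ltrDl.
  by lra.
apply: geometric_decay (ltW q0) _ => n; rewrite geq_max => /andP[Nn N1n].
have [r0|rN0] := eqVneq (r n) 0.
  by rewrite r0 mulr0 -[leRHS]r0 r_dec.
have rP : 0 < r n by rewrite lt_def rN0 r_ge0.
have r1 : r n < 1 by have := HN1 n N1n; rewrite ger0_norm.
have : r n <= r n `^ (2 * theta).
  by apply: ger1_powR; [rewrite rP ltW|lra].
move=> /(ler_wpM2l (ltW kappa_gt0)) H; have := r_rec _ Nn rP.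
by have := ler_wpM2r (r_ge0 n) q1; lra.
Qed.

(** Sublinear decay with p = 2 theta - 1 bounds r^p by a multiple of 1/n; raising to the power (1 -
    theta)/p gives the rate. The base is [n.+1] because [r n] will control the iterate of index n +
    1. *)
Lemma polynomial_decay : 2^-1 < theta < 1 -> exists (C : R) (K : nat),
  [/\ 0 < C, (N <= K)%N & forall n, (K <= n)%N ->
    r n `^ (1 - theta) <= C * n.+1%:R `^ (- ((1 - theta) / (2 * theta - 1)))].
Proof.
move=> /andP[th0 th1]; set p := 2 * theta - 1.
have p0 : 0 < p by rewrite /p; lra.
have p1 : p <= 1 by rewrite /p; lra.
have pk0 : 0 < p * kappa by rewrite mulr_gt0.
have rec n : (N <= n)%N -> kappa * r n `^ (1 + p) <= r n - r n.+1.
  move=> Nn; have -> : 1 + p = 2 * theta by rewrite /p; ring.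
  have [r0|rN0] := eqVneq (r n) 0; last by apply: r_rec => //; rewrite lt_def rN0 r_ge0.
  by rewrite r0 powR0 ?mulr0 ?subr_ge0 -?[leRHS]r0 ?r_dec// gt_eqF//; lra.
have p01 : 0 < p <= 1 by rewrite p0.
have sub := sublinear_decay (ltW kappa_gt0) p01 r_ge0 rec.
set s := (1 - theta) / p.
have s0 : 0 < s by rewrite divr_gt0// subr_gt0.
(* For n > 2N one has n + 1 <= 2 (n - N), so the shift by [N] costs only the factor 2. *)
exists ((2 / (p * kappa)) `^ s), (N + N).+1; split.
- by rewrite powR_gt0// divr_gt0.
- by rewrite -addnS leq_addr.
move=> n Nn; have NN : (N <= n)%N by rewrite (leq_trans _ Nn)// -addnS leq_addr.
have := sub (n - N)%N; rewrite subnKC// => H.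
have n0 : 0 < n.+1%:R :> R by rewrite ltr0n.
have le2 : n.+1%:R <= 2 * (n - N)%N%:R :> R.
  rewrite -natrM ler_nat mulnBr leq_subRL; last first.
    by rewrite leq_mul2l NN.
  by rewrite mul2n -addnn addnS -addSn [leqRHS]mul2n -addnn leq_add2r.
have rp : r n `^ p <= 2 / (p * kappa) / n.+1%:R.
  rewrite ler_pdivlMr// ler_pdivlMr//.
  have := ler_wpM2l (mulr_ge0 (powR_ge0 (r n) p) (ltW pk0)) le2.
  by nra.
have -> : 1 - theta = p * s by rewrite /s mulrC divfK// gt_eqF.
have -> : n.+1%:R `^ (- s) = (n.+1%:R^-1 : R) `^ s.
  by rewrite -powR_inv1 ?(ltW n0)// -powRrM mulN1r.
rewrite powRrM.
have k0 : 0 <= 2 / (p * kappa) by rewrite divr_ge0// ltW.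
rewrite -powRM ?invr_ge0 ?(ltW n0)//.
by apply: ge0_ler_powR; rewrite ?nnegrE ?powR_ge0 ?(ltW s0)// divr_ge0 ?(ltW n0).
Qed.

End Rates.

(** * Descent under a Kurdyka-Lojasiewicz inequality *)

Section KLDescent.
Context {R : realType}.

(** Concavity bounds the right side below by K (1 - theta) s^(-theta) (s - s'), hence by a multiple
    of e^2; the KL inequality absorbs one factor e. The bound is linear in e, so it telescopes into
    a bound on path length. *)
Lemma KL_length_le {theta c K s s' e : R} : 0 <= theta < 1 -> 0 < c -> 0 <= K ->
  0 <= s -> 0 <= s' -> 0 <= e -> c * e ^+ 2 <= s - s' ->
  (0 < s -> 1 <= K * s `^ (- theta) * e) ->
  c * (1 - theta) * e <= K * (s `^ (1 - theta) - s' `^ (1 - theta)).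
Proof.
move=> /andP[t0 t1] c0 K0 s0 s'0 e0 dec KL.
have ce0 : 0 <= c * e ^+ 2 by rewrite mulr_ge0 ?sqr_ge0// ltW.
have [s_eq0|sN0] := eqVneq s 0.
  have s'_eq0 : s' = 0 by apply/le_anti; rewrite s'0 andbT; lra.
  have : e ^+ 2 = 0 by nra.
  by move=> /eqP; rewrite sqrf_eq0 => /eqP ->; rewrite s_eq0 s'_eq0 subrr !mulr0.
have sP : 0 < s by rewrite lt_def sN0.
have := @powR_sub_ge_tangent R s s' (1 - theta) sP s'0.
have -> : 1 - theta - 1 = - theta by ring.
have -> : 0 <= 1 - theta <= 1 by apply/andP; lra.
move=> /(_ isT)/(ler_wpM2l K0); apply: le_trans.
have u0 := powR_ge0 s (- theta).
have {}KL := KL sP.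
have w0 : 0 <= K * ((1 - theta) * s `^ (- theta)) by rewrite !mulr_ge0// subr_ge0 ltW.
have := ler_wpM2l w0 dec.
have v0 : 0 <= c * (1 - theta) * e by rewrite !mulr_ge0// ?subr_ge0 ltW.
have := ler_wpM2l v0 KL.
nra.
Qed.

(** The KL inequality says e >= s^theta / K; insert this into the quadratic decrease. *)
Lemma KL_decrease_ge {theta c K s s' e : R} : 0 < c -> 0 < K ->
  0 < s -> 0 <= e -> c * e ^+ 2 <= s - s' ->
  1 <= K * s `^ (- theta) * e ->
  c / K ^+ 2 * s `^ (2 * theta) <= s - s'.
Proof.
move=> c0 K0 sP e0 dec KL; apply: le_trans dec.
rewrite -mulrA ler_pM2l// ler_pdivrMl ?exprn_gt0//.
have sT : 0 < s `^ theta by rewrite powR_gt0.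
have sE : s `^ (2 * theta) = (s `^ theta) ^+ 2.
  by rewrite mulrC powRrM -powR_mulrn// powR_ge0.
rewrite sE -exprMn lerXn2r ?nnegrE ?mulr_ge0 ?(ltW K0) ?(ltW sT)//.
by move: KL; rewrite powRN mulrAC ler_pdivlMr// mul1r.
Qed.

(* Started close enough to [xbar] with [T] small, the sequence is trapped in
   the ball on which its increments are controlled by those of [T]. *)
Lemma cvg_of_local_length_bound {V : normedModType R} {x : nat -> V} {xbar : V}
    {T : nat -> R} {eps : R} {N : nat} : 0 < eps ->
  (forall n, 0 <= T n) -> T @ \oo --> 0 ->
  (forall e (M : nat), 0 < e -> exists2 n, (M <= n)%N & `|x n - xbar| < e) ->
  (forall n, (N <= n)%N -> `|x n - xbar| < eps ->
     `|x n.+1 - x n| <= T n - T n.+1) ->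
  x @ \oo --> xbar /\
  exists K, forall n, (K <= n)%N -> `|x n - xbar| < eps /\ `|x n - xbar| <= T n.
Proof.
move=> eps0 T0 Tcvg xfreq H.
have e2 : 0 < eps / 2 by rewrite divr_gt0.
have /cvgr0Pnorm_lt/(_ _ e2)[M _ HM] := Tcvg.
have [k0 k0M xk0] := xfreq _ (maxn M N) e2.
have Tk0 : T k0 < eps / 2.
  by have := HM k0 (leq_trans (leq_maxl _ _) k0M); rewrite ger0_norm.
have k0N : (N <= k0)%N := leq_trans (leq_maxr _ _) k0M.
(* The increments telescope to at most T k0 < eps/2, and [x k0] is itself within eps/2 of [xbar], so
   the next point stays in the ball. *)
have trap m : `|x (k0 + m)%N - x k0| <= T k0 - T (k0 + m)%N /\
    `|x (k0 + m)%N - xbar| < eps.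
  have near_xbar w : `|w - x k0| <= T k0 -> `|w - xbar| < eps.
    move=> Hw; have -> : w - xbar = (w - x k0) + (x k0 - xbar).
      by rewrite addrA subrK.
    by have := ler_normD (w - x k0) (x k0 - xbar); lra.
  elim: m => [|m [IH1 IH2]].
    rewrite addn0 !subrr normr0; split=> //.
    by lra.
  have Hm : `|x (k0 + m.+1)%N - x k0| <= T k0 - T (k0 + m.+1)%N.
    rewrite addnS.
    have -> : x (k0 + m).+1 - x k0 = (x (k0 + m).+1 - x (k0 + m)%N) + (x (k0 + m)%N - x k0).
      by rewrite addrA subrK.
    have := ler_normD (x (k0 + m).+1 - x (k0 + m)%N) (x (k0 + m)%N - x k0).
    by have := H _ (leq_trans k0N (leq_addr m k0)) IH2; lra.
  split=> //; apply: near_xbar; apply: le_trans Hm _.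
  by have := T0 (k0 + m.+1)%N; lra.
have inball n : (k0 <= n)%N -> `|x n - xbar| < eps.
  by move=> kn; have := (trap (n - k0)%N).2; rewrite subnKC.
have tail n m : (k0 <= n)%N -> `|x (n + m)%N - x n| <= T n - T (n + m)%N.
  move=> kn; elim: m => [|m IH]; first by rewrite addn0 !subrr normr0.
  rewrite addnS.
  have -> : x (n + m).+1 - x n = (x (n + m).+1 - x (n + m)%N) + (x (n + m)%N - x n).
    by rewrite addrA subrK.
  have := ler_normD (x (n + m).+1 - x (n + m)%N) (x (n + m)%N - x n).
  have knm : (k0 <= n + m)%N := leq_trans kn (leq_addr m n).
  by have := H _ (leq_trans k0N knm) (inball _ knm); lra.
(* Compare [x n] with a later iterate arbitrarily close to [xbar]; the path between them has length
   at most [T n]. *)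
have bnd n : (k0 <= n)%N -> `|x n - xbar| <= T n.
  move=> kn; apply/ler_addgt0Pr => e e0.
  have [m nm Hm] := xfreq _ n e0.
  have := tail n (m - n)%N kn; rewrite subnKC// => Ht.
  have -> : x n - xbar = - (x m - x n) + (x m - xbar).
    by rewrite opprB addrA subrK.
  have := ler_normD (- (x m - x n)) (x m - xbar); rewrite normrN.
  by have := T0 m; lra.
split; last by exists k0 => n kn; split; [exact: inball|exact: bnd].
apply/subr_cvg0/norm_cvg0P.
apply: (@squeeze_cvgr _ _ _ _ (fun=> 0) T) => //; last exact: cvg_cst.
by exists k0 => // n /= kn; rewrite normr_ge0 bnd.
Qed.

End KLDescent.

(** * Euclidean spaces *)

Section InnerProduct.
Context {R : realType} {V : euclidType R}.
Implicit Types u v w : V.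

Lemma innerDr u v w : inner u (v + w) = inner u v + inner u w.
Proof. by rewrite innerC innerDl [inner v _]innerC [inner w _]innerC. Qed.

Lemma innerZr (a : R) u v : inner u (a *: v) = a * inner u v.
Proof. by rewrite innerC innerZl innerC. Qed.

Lemma innerNl u v : inner (- u) v = - inner u v.
Proof. by rewrite -scaleN1r innerZl mulN1r. Qed.

Lemma innerNr u v : inner u (- v) = - inner u v.
Proof. by rewrite innerC innerNl innerC. Qed.

Lemma innerBl u v w : inner (u - v) w = inner u w - inner v w.
Proof. by rewrite innerDl innerNl. Qed.

Lemma innerBr u v w : inner u (v - w) = inner u v - inner u w.
Proof. by rewrite innerDr innerNr. Qed.

Lemma inner0l u : inner 0 u = 0.
Proof. by rewrite -(scale0r u) innerZl mul0r. Qed.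

Lemma inner0r u : inner u 0 = 0.
Proof. by rewrite innerC inner0l. Qed.

(** Cauchy-Schwarz, by expanding the squared norm of |v| u - |u| v. *)
Lemma inner_le u v : inner u v <= `|u| * `|v|.
Proof.
have [->|uN0] := eqVneq u 0; first by rewrite inner0l normr0 mul0r.
have [->|vN0] := eqVneq v 0; first by rewrite inner0r normr0 mulr0.
have uP : 0 < `|u| by rewrite normr_gt0.
have vP : 0 < `|v| by rewrite normr_gt0.
have := inner_norm (`|v| *: u - `|u| *: v).
rewrite innerBl !innerBr !innerZl !innerZr !inner_norm [inner v u]innerC => E.
have : 0 <= `|u| * `|v| * (`|u| * `|v| - inner u v).
  have -> : `|u| * `|v| * (`|u| * `|v| - inner u v) =
    `| `|v| *: u - `|u| *: v| ^+ 2 / 2 by rewrite -E; field.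
  by rewrite divr_ge0 ?sqr_ge0.
by rewrite pmulr_rge0 ?mulr_gt0// subr_ge0.
Qed.

Lemma norm_inner_le u v : `|inner u v| <= `|u| * `|v|.
Proof.
by rewrite ler_norml inner_le lerNl -innerNl -[in leRHS](normrN u) inner_le.
Qed.

(** Reduces vector identities to scalar ones, which [ring] and [field] then settle. *)
Lemma inner_ext {u v : V} : (forall w, inner u w = inner v w) -> u = v.
Proof.
move=> H; apply/eqP; rewrite -subr_eq0 -normr_eq0 -sqrf_eq0 -inner_norm.
by rewrite innerBl H subrr.
Qed.

Lemma inner_young {u v} {t : R} : 0 < t ->
  - inner u v <= t / 2 * `|u| ^+ 2 + t^-1 / 2 * `|v| ^+ 2.
Proof.
move=> t0; have := inner_le u (- v); rewrite innerNr normrN => H.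
apply: (le_trans H); rewrite -subr_ge0.
have -> : t / 2 * `|u| ^+ 2 + t^-1 / 2 * `|v| ^+ 2 - `|u| * `|v| =
  (t * `|u| - `|v|) ^+ 2 / (2 * t) by field; rewrite gt_eqF.
by rewrite divr_ge0 ?sqr_ge0// mulr_ge0// ltW.
Qed.

Lemma inner_cvg {u v : nat -> V} {l m : V} :
  u @ \oo --> l -> v @ \oo --> m -> (inner (u n) (v n)) @[n --> \oo] --> inner l m.
Proof.
move=> ul vm; apply/subr_cvg0.
have E n : inner (u n) (v n) - inner l m = inner (u n - l) (v n) + inner l (v n - m).
  by rewrite innerBl innerBr; ring.
under eq_fun do rewrite E.
rewrite -(addr0 0); apply: cvgD; apply/norm_cvg0P.
  apply: (@squeeze_cvgr _ _ _ _ (fun=> 0) (fun n => `|u n - l| * `|v n|)).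
  - by near=> n; rewrite normr_ge0 norm_inner_le.
  - exact: cvg_cst.
  - rewrite -(mul0r `|m|); apply: cvgM; last exact: cvg_norm.
    by apply/norm_cvg0P/subr_cvg0.
apply: (@squeeze_cvgr _ _ _ _ (fun=> 0) (fun n => `|l| * `|v n - m|)).
- by near=> n; rewrite normr_ge0 norm_inner_le.
- exact: cvg_cst.
- rewrite -(mulr0 `|l|); apply: cvgM; first exact: cvg_cst.
  by apply/norm_cvg0P/subr_cvg0.
Unshelve. all: by end_near. Qed.

End InnerProduct.

(** * Coordinates and equivalence of norms *)

Section Coordinates.
Context {R : realType} {V : euclidType R}.
Local Notation n := (\dim {:V}).

Definition lincomb (r : 'rV[R]_n) : V := \sum_i r ord0 i *: (vbasis {:V})`_i.

Definition coords (v : V) : 'rV[R]_n := \row_i coord (vbasis {:V}) i v.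

Lemma coordsK : cancel coords lincomb.
Proof.
move=> v; rewrite [RHS](coord_vbasis (memvf v)).
by apply: eq_bigr => i _; rewrite mxE.
Qed.

Lemma lincombK : cancel lincomb coords.
Proof.
move=> r; apply/rowP => i; rewrite mxE coord_sum_free//.
exact: basis_free (vbasisP _).
Qed.

Lemma lincombZ a r : lincomb (a *: r) = a *: lincomb r.
Proof. by rewrite scaler_sumr; apply: eq_bigr => i _; rewrite mxE scalerA. Qed.

Lemma lincomb_continuous : continuous lincomb.
Proof.
apply: continuous_big => [|i _]; first exact: add_continuous.
move=> r; apply: cvgZr_tmp; last exact: coord_continuous.
exact: nbhs_filter.
Qed.

Lemma norm_entry_le (r : 'rV[R]_n) i : `|r ord0 i| <= `|r|.
Proof.
rewrite [leRHS]/Num.Def.normr /= mx_normrE; apply/bigmax_geP; right => /=.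
by exists (ord0, i).
Qed.

(* The norm of [lincomb r] has a positive minimum over the unit sphere of
   ['rV_n], which is compact. *)
Lemma coords_bounded : exists2 C : R, 0 < C & forall v : V, `|coords v| <= C * `|v|.
Proof.
pose S := [set r : 'rV[R]_n | `|r| = 1].
have N_cont : continuous (fun r => `|lincomb r|).
  move=> r; apply: (@continuous_comp _ _ _ lincomb (fun v : V => `|v|)).
    exact: lincomb_continuous.
  exact: norm_continuous.
have normc : continuous (fun r : 'rV[R]_n => `|r|) by move=> r; exact: norm_continuous.
(* An empty sphere means dimension zero; every coordinate vector then vanishes. *)
have [S0|/set0P S0] := eqVneq S set0.
  exists 1 => // v; have [->|cN0] := eqVneq (coords v) 0.
    by rewrite normr0 mul1r.
  suff : S (`|coords v|^-1 *: coords v) by rewrite S0.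
  by rewrite /S /= normrZ normfV normr_id mulVf ?normr_eq0.
have cS : compact S.
  apply: bounded_closed_compact.
    exists 1; split=> // M M1 r; rewrite /S /= => ->; exact: ltW.
  rewrite (_ : S = (fun r : 'rV[R]_n => `|r|) @^-1` [set 1])//.
  by apply: closed_comp => [r _|]; [exact: normc|exact: closed_eq].
have [r0 r0S r0min] := compact_EVT_min S0 cS (continuous_subspaceT N_cont).
have lP : 0 < `|lincomb r0|.
  rewrite normr_gt0; apply/eqP => E.
  have : r0 = 0 by rewrite -(lincombK r0) E; apply/rowP => i; rewrite !mxE linear0.
  by move=> r00; move: r0S; rewrite r00 inE /S /= normr0 => /esym/eqP; rewrite oner_eq0.
exists `|lincomb r0|^-1; first by rewrite invr_gt0.
move=> v; have [->|cN0] := eqVneq (coords v) 0.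
  by rewrite normr0 mulr_ge0 ?invr_ge0.
have := r0min (`|coords v|^-1 *: coords v).
rewrite inE /S /= normrZ normfV normr_id mulVf ?normr_eq0// => /(_ erefl).
rewrite lincombZ normrZ normfV normr_id coordsK => H.
rewrite ler_pdivlMl// mulrC -ler_pdivlMl ?normr_gt0//.
Qed.

End Coordinates.

(** * Compactness and continuity in finite dimension *)

Section BoundedSets.
Context {R : realType}.

(** [S] is a closed subset of the continuous image, under [lincomb], of a compact ball of row
    vectors. *)
Lemma bounded_closed_compact_euclid {V : euclidType R} (S : set V) (C : R) :
  (forall v, S v -> `|v| <= C) -> closed S -> compact S.
Proof.
move=> SC clS; have [D D0 HD] := @coords_bounded R V.
pose B := [set r : 'rV[R]_(\dim {:V}) | `|r| <= D * C].
have cB : compact B.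
  apply: bounded_closed_compact.
    by exists (D * C); split; [exact: num_real|move=> M M1 r /= /le_trans; apply; exact: ltW].
  rewrite (_ : B = (fun r : 'rV[R]_(\dim {:V}) => `|r|) @^-1` [set t | t <= D * C])//.
  by apply: closed_comp => [r _|]; [exact: norm_continuous|exact: closed_le].
apply: (subclosed_compact clS (continuous_compact (continuous_subspaceT (@lincomb_continuous R V)) cB)).
move=> v /SC vC; exists (coords v); last exact: coordsK.
by rewrite /B /= (le_trans (HD v))// ler_wpM2l// ltW.
Qed.

Lemma linear_bounded_euclid {V W : euclidType R} (A : 'Hom(V, W)) :
  exists2 C : R, 0 <= C & forall v, `|A v| <= C * `|v|.
Proof.
have [D D0 HD] := @coords_bounded R V.
pose C := \sum_(i < \dim {:V}) `|A (vbasis {:V})`_i|.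
have C0 : 0 <= C by apply: sumr_ge0.
exists (C * D); first by rewrite mulr_ge0// ltW.
move=> v; rewrite -{1}(coordsK v) /lincomb linear_sum/=.
apply: (le_trans (ler_norm_sum _ _ _)).
rewrite -mulrA; apply: (@le_trans _ _ (C * `|coords v|)); last by rewrite ler_wpM2l.
rewrite mulr_suml; apply: ler_sum => i _.
by rewrite linearZ normrZ mulrC ler_wpM2l// norm_entry_le.
Qed.

Lemma hom_cvg {V W : euclidType R} (A : 'Hom(V, W)) (u : nat -> V) (l : V) :
  u @ \oo --> l -> (A (u n)) @[n --> \oo] --> A l.
Proof.
move=> ul; have [C C0 HC] := linear_bounded_euclid A.
apply/subr_cvg0/norm_cvg0P.
apply: (@squeeze_cvgr _ _ _ _ (fun=> 0) (fun n => C * `|u n - l|)).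
- by near=> n; rewrite normr_ge0 -linearB HC.
- exact: cvg_cst.
- rewrite -(mulr0 C); apply: cvgM; first exact: cvg_cst.
  by apply/norm_cvg0P/subr_cvg0.
Unshelve. all: by end_near. Qed.

(** The selection [phi] need not be increasing: n <= phi n already transfers limits at infinity. *)
Lemma bounded_seq_cluster {V : euclidType R} {u : nat -> V} {C : R} :
  (forall n, `|u n| <= C) ->
  exists (phi : nat -> nat) (l : V),
    (forall n, (n <= phi n)%N) /\ (u \o phi) @ \oo --> l.
Proof.
move=> uC; pose B := [set v : V | `|v| <= C].
have clB : closed B.
  rewrite (_ : B = (fun r : V => `|r|) @^-1` [set t | t <= C])//.
  by apply: closed_comp => [r _|]; [exact: norm_continuous|exact: closed_le].
have cB : compact B by apply: (@bounded_closed_compact_euclid V B C).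
have [l [_ lcl]] : B `&` cluster (u @ \oo) !=set0.
  by apply: cB; exists 0%N => // n _; exact: uC.
have freq n : exists m, (n <= m)%N /\ `|l - u m| < n.+1%:R^-1.
  have /(lcl [set u m | m in [set m | (n <= m)%N]]) : nbhs l (ball l (n.+1%:R^-1 : R)).
    by apply: nbhsx_ballx; rewrite invr_gt0.
  case; first by exists n => // m nm; exists m.
  by move=> _ [[m nm <-]]; rewrite -ball_normE /= => H; exists m.
have [phi Hphi] := choice freq.
exists phi, l; split=> [n|]; first by have [] := Hphi n.
apply/cvgrPdist_lt => e e0; near=> n.
apply: (lt_trans (Hphi n).2).
by near: n; exact: near_infty_natSinv_lt (PosNum e0).
Unshelve. all: by end_near. Qed.

Lemma cvg_subseq {T : topologicalType} {u : nat -> T} {l : T} {phi : nat -> nat} :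
  (forall n, (n <= phi n)%N) -> u @ \oo --> l -> (u \o phi) @ \oo --> l.
Proof.
move=> Hphi ul; apply: cvg_comp ul => S [N _ HN].
by exists N => // n /= Nn; apply: HN => /=; exact: leq_trans Nn (Hphi n).
Qed.

End BoundedSets.

(** * The adjoint and the smallest eigenvalue of [A \o AT] *)

Section Adjoint.
Context {R : realType} {X Y : euclidType R} {A : 'Hom(X, Y)} {AT : 'Hom(Y, X)}.
Hypothesis A_adj : is_adjoint A AT.

(** The kernel of [AT] is orthogonal to the range of [A], which is everything. *)
Lemma adjoint_inj : (forall w, exists u, A u = w) -> forall w, AT w = 0 -> w = 0.
Proof.
move=> A_surj w ATw; have [u Au] := A_surj w.
apply/eqP; rewrite -normr_eq0 -sqrf_eq0 -inner_norm -{2}Au A_adj ATw.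
by rewrite inner0l.
Qed.

Lemma leigenvalueP (B : 'End(Y)) m :
  reflect (exists2 w, w != 0 & B w = m *: w) (passmx.leigenvalue B m).
Proof.
apply: (iffP idP) => [|[w wN0 Bw]].
  rewrite /passmx.leigenvalue -subv0 => /subvPn[w].
  rewrite memv_ker !lfunE/= !lfunE/= !lfunE/= id_lfunE subr_eq0 memv0 => /eqP Bw wN0.
  by exists w.
rewrite /passmx.leigenvalue -subv0; apply/subvPn; exists w; last by rewrite memv0.
by rewrite memv_ker !lfunE/= !lfunE/= !lfunE/= id_lfunE subr_eq0 Bw.
Qed.

(* A minimizer of the Rayleigh quotient of [A A^T] is an eigenvector, because
   the first variation of the quotient vanishes there. *)
Lemma min_eigenvalue_le {lambda : R} : is_min_eigenvalue (A \o AT)%VF lambda ->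
  forall w, lambda * `|w| ^+ 2 <= `|AT w| ^+ 2.
Proof.
move=> [/leigenvalueP[v vN0 _] lmin].
pose S := [set w : Y | `|w| = 1].
have normalized w : w != 0 -> S (`|w|^-1 *: w).
  by move=> wN0; rewrite /S /= normrZ normfV normr_id mulVf ?normr_eq0.
have S0 : S !=set0 by exists (`|v|^-1 *: v); exact: normalized.
have clS : closed S.
  rewrite (_ : S = (fun r : Y => `|r|) @^-1` [set 1])//.
  by apply: closed_comp => [r _|]; [exact: norm_continuous|exact: closed_eq].
have cS : compact S.
  by apply: (@bounded_closed_compact_euclid _ _ _ 1) => // w ->.
have AT_cont : continuous (AT : Y -> X).
  by move=> w; have [C C0 HC] := linear_bounded_euclid AT;
    apply: bounded_linear_continuous; apply/bounded_funP => r; exists (C * r) => u ur;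
    apply: le_trans (HC u) _; rewrite ler_wpM2l.
have N_cont : continuous (fun w => `|AT w|).
  move=> w; apply: (@continuous_comp _ _ _ (AT : Y -> X) (fun v : X => `|v|)).
    exact: AT_cont.
  exact: norm_continuous.
have [w0 w0S w0min] := compact_EVT_min S0 cS (continuous_subspaceT N_cont).
set m := `|AT w0| ^+ 2.
have m_le w : m * `|w| ^+ 2 <= `|AT w| ^+ 2.
  have [->|wN0] := eqVneq w 0; first by rewrite normr0 expr0n mulr0 sqr_ge0.
  rewrite -exprMn lerXn2r ?nnegrE ?mulr_ge0//.
  have /w0min : `|w|^-1 *: w \in S by rewrite inE; exact: normalized.
  by rewrite linearZ normrZ normfV normr_id ler_pdivlMl ?normr_gt0// mulrC.
have w0n : `|w0| = 1 by move: w0S; rewrite inE.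
pose u := (A \o AT)%VF w0 - m *: w0.
have u0 : u = 0.
  apply/eqP; rewrite -normr_eq0 -sqrf_eq0; apply/eqP.
  (* Vary [w0] in the direction of the residual [u] itself: the linear coefficient is then |u|^2,
     which must vanish. *)
  apply: (@ge0_quadratic_linear_coef R _ (`|AT u| ^+ 2 - m * `|u| ^+ 2)); first exact: sqr_ge0.
  have uE : inner (AT w0) (AT u) = inner u u + m * inner w0 u.
    rewrite innerC -A_adj innerC.
    have -> : A (AT w0) = u + m *: w0 by rewrite /u lfunE/= subrK.
    by rewrite innerDl innerZl.
  clearbody u; move=> t; have := m_le (w0 + t *: u).
  rewrite -!inner_norm linearD linearZ/= !(innerDl, innerDr) !(innerZl, innerZr).
  rewrite [inner u w0]innerC [inner (AT u) (AT w0)]innerC.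
  rewrite uE [inner w0 w0]inner_norm w0n [inner (AT w0) _]inner_norm -/m.
  by move=> H; nra.
have : lambda <= m.
  apply: lmin; apply/leigenvalueP; exists w0.
    by rewrite -normr_eq0 w0n oner_eq0.
  by move/eqP: u0; rewrite subr_eq0 => /eqP.
move=> lm w; apply: le_trans (m_le w).
by rewrite ler_wpM2r// sqr_ge0.
Qed.

Lemma min_eigenvalue_gt0 {lambda : R} : (forall w, exists u, A u = w) ->
  is_min_eigenvalue (A \o AT)%VF lambda -> 0 < lambda.
Proof.
move=> A_surj [/leigenvalueP[v vN0]]; rewrite lfunE/= => Bv _.
have E : lambda * `|v| ^+ 2 = `|AT v| ^+ 2.
  by rewrite -!inner_norm -A_adj Bv innerZr.
have ATv : 0 < `|AT v| ^+ 2.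
  rewrite exprn_gt0// normr_gt0; apply: contra_neq vN0.
  exact: adjoint_inj.
by move: ATv; rewrite -E pmulr_lgt0// exprn_gt0// normr_gt0.
Qed.

Lemma adjoint_norm_ge {lambda : R} : 0 <= lambda ->
  is_min_eigenvalue (A \o AT)%VF lambda ->
  forall w, Num.sqrt lambda * `|w| <= `|AT w|.
Proof.
move=> l0 lmin w.
rewrite -(@ler_pXn2r _ 2) ?nnegrE ?mulr_ge0 ?sqrtr_ge0//.
by rewrite exprMn sqr_sqrtr// min_eigenvalue_le.
Qed.

(** If A (AT w) = 0 then |AT w|^2 = 0, so [M] is injective, hence onto by dimension, and the
    pseudo-inverse [M^-1] is a true inverse. *)
Lemma preconditioner_invK {alpha : R} : (forall w, exists u, A u = w) -> alpha != 0 ->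
  let M : 'End(Y) := alpha *: (A \o AT)%VF in cancel (M^-1)%VF M.
Proof.
move=> A_surj aN0 M.
have M0 : lker M == 0%VS.
  rewrite -subv0; apply/subvP => w; rewrite memv_ker !lfunE/= lfunE/=.
  rewrite scaler_eq0 (negbTE aN0)/= => /eqP AATw; rewrite memv0.
  apply/eqP/(adjoint_inj A_surj)/eqP; rewrite -normr_eq0 -sqrf_eq0 -inner_norm.
  by rewrite -A_adj AATw inner0r.
move=> w; apply: limg_lfunVK.
suff /eqP -> : limg M == fullv by rewrite memvf.
by rewrite eqEdim subvf/= limg_dim_eq// (eqP M0) capv0.
Qed.

End Adjoint.

(** * Conjugates and the descent lemma *)

Section Conjugate.
Context {R : realType} {V : euclidType R} {h : V -> \bar R}.
Hypothesis h_gtNy : forall u, (-oo < h u)%E.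
Local Notation g := (conjugate h).

(** The right-hand inequalities are affine in [y], so convexity and lower semicontinuity of [g] are
    read off from this form. Points where [h] is infinite contribute -oo to the supremum. *)
Lemma conjugate_leP {y : V} {c : R} :
  (g y <= c%:E)%E <-> forall u r, h u = r%:E -> inner y u - r <= c.
Proof.
split=> [gyc u r hu|H].
  rewrite -lee_fin EFinB -hu; apply: le_trans gyc.
  by apply: ereal_sup_ubound; exists u.
apply: ge_ereal_sup => _ [u _ <-]; have := h_gtNy u; case hu : (h u) => [r||] // _.
  by rewrite -EFinB lee_fin H.
by rewrite addeNy leNye.
Qed.

Lemma conjugate_convex {y v : V} {a b t : R} : 0 <= t <= 1 ->
  g y = a%:E -> g v = b%:E -> (g (y + t *: (v - y))%R <= ((1 - t) * a + t * b)%:E)%E.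
Proof.
move=> /andP[t0 t1] gy gv; apply/conjugate_leP => u r hu.
have Hy : inner y u - r <= a by apply: (conjugate_leP.1 _ _ _ hu); rewrite gy.
have Hv : inner v u - r <= b by apply: (conjugate_leP.1 _ _ _ hu); rewrite gv.
have := ler_wpM2l t0 Hv.
have t'0 : 0 <= 1 - t by rewrite subr_ge0.
have := ler_wpM2l t'0 Hy.
by rewrite innerDl innerZl innerBl; lra.
Qed.

(** Were [h] identically +oo, its epigraph and the convex hull of that would be empty, and the
    convex hull of [h] would not be proper. One point of finite value bounds [g] below. *)
Lemma conjugate_gtNy : proper_fun (convex_hull_fun h) -> forall y, (-oo < g y)%E.
Proof.
move=> [[y0 hy0] _] y.
suff [u hu] : exists u, (h u < +oo)%E.
  apply: (@lt_le_trans _ _ ((inner y u)%:E - h u)%E).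
    by have := h_gtNy u; case: (h u) hu => [r||]// _ _; rewrite -EFinB ltNyr.
  by apply: ereal_sup_ubound; exists u.
apply: contrapT => /forallNP hoo.
suff : convex_hull_fun h y0 = +oo%E by move=> E; rewrite E ltxx in hy0.
rewrite /convex_hull_fun (_ : [set r : R | _] = set0) ?image_set0 ?ereal_inf0//.
rewrite -subset0 => r; apply: (@smallest_sub _ _ _ set0).
  by move=> u v l; rewrite inE.
move=> [u s] /=; rewrite /epigraph /= => hus; case: (hoo u).
by rewrite (le_lt_trans hus)// ltry.
Qed.

(** Compare the minimizer [p] with p + t (v - p), bound [g] there by convexity, divide by t and let
    t go to 0. *)
Lemma prox_subdiff {M : 'End(V)} {w p : V} :
  (forall u v, inner (M u) v = inner u (M v)) -> (forall y, (-oo < g y)%E) ->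
  prox M g w p -> subdiff g p (M (w - p)).
Proof.
move=> M_sym gN [].
have := gN p; case gp : (g p) => [a||]// _ _ H; split=> [|v]; first by rewrite gp.
have := gN v; rewrite gp; case gv : (g v) => [b||]// _; rewrite ?leey//.
rewrite -EFinD lee_fin -subr_ge0.
apply: (@ge0_of_affine_ge0 R _ (2^-1 * inner (M (v - p)) (v - p))).
move=> t /andP[t0 t1].
have t01 : 0 <= t <= 1 by rewrite t1 ltW.
have := conjugate_convex t01 gp gv; have := H (p + t *: (v - p)).
have := gN (p + t *: (v - p)).
case: (g (p + _)) => [c||] // _.
rewrite -!EFinD !lee_fin => H2 H1.
rewrite -(pmulr_rge0 _ t0).
have E : p + t *: (v - p) - w = t *: (v - p) - (w - p).
  by rewrite opprB [p + _]addrC addrA.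
have E2 : p - w = - (w - p) by rewrite opprB.
move: H2; rewrite E E2; move: (v - p) (w - p) => d e.
have -> : M (t *: d - e) = t *: M d - M e by rewrite linearB linearZ.
have -> : M (- e) = - M e by rewrite linearN.
rewrite !(innerBl, innerBr) !(innerNl, innerNr) opprK !(innerZl, innerZr).
rewrite [inner (M d) e]M_sym [inner d (M e)]innerC.
by nra.
Qed.

(** Lower semicontinuity gives [g ybar <= cbar]; the limit of the subgradient inequalities, tested
    at [ybar], gives the converse. *)
Lemma subdiff_conjugate_closed {y p : nat -> V} {c : nat -> R} {ybar pbar : V} {cbar : R} :
  y @ \oo --> ybar -> p @ \oo --> pbar -> c @ \oo --> cbar ->
  (forall n, g (y n) = (c n)%:E) -> (forall n, subdiff g (y n) (p n)) ->
  g ybar = cbar%:E /\ subdiff g ybar pbar.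
Proof.
move=> yl pl cl gy sub.
have lsc : (g ybar <= cbar%:E)%E.
  apply/conjugate_leP => u r hu.
  apply: (@ler_cvg_seq R (fun n => inner (y n) u - r) c) => // [|n].
    by apply: cvgB; [apply: inner_cvg => //|]; exact: cvg_cst.
  by apply: (conjugate_leP.1 _ _ _ hu); rewrite gy.
have sg w : (cbar%:E + (inner pbar (w - ybar))%:E <= g w)%E.
  have H n : ((c n)%:E + (inner (p n) (w - y n))%:E <= g w)%E.
    by rewrite -gy; exact: (sub n).2.
  case gw : (g w) => [r||].
  - rewrite -EFinD lee_fin.
    apply: (@ler_cvg_seq R (fun n => c n + inner (p n) (w - y n)) (fun=> r)).
    + apply: cvgD => //; apply: inner_cvg => //.
      by apply: cvgB => //; exact: cvg_cst.
    + exact: cvg_cst.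
    + by move=> n; rewrite -lee_fin EFinD -gw.
  - by rewrite leey.
  - by have := H 0%N; rewrite gw -EFinD leNgt ltNyr.
have gE : g ybar = cbar%:E.
  apply/le_anti; rewrite lsc/=.
  by have := sg ybar; rewrite subrr inner0r adde0.
by split=> //; split; rewrite gE.
Qed.

End Conjugate.

(** * The descent lemma for Lipschitz gradients *)

Section Descent.
Context {R : realType} {X : euclidType R} {f : X -> R} {gradf : X -> X} {L : R}.
Hypothesis f_C1 : is_C1_gradient f gradf.
Hypothesis f_lip : forall u v, `|gradf u - gradf v| <= L * `|u - v|.

Lemma is_derive_line (x d : X) (t : R) :
  is_derive t (1 : R) (fun t => f (x + t *: d)) (inner (gradf (x + t *: d)) d).
Proof.
have [f_diff f_grad] := f_C1.1 (x + t *: d).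
have E : (fun k : R => k^-1 *: (((fun t => f (x + t *: d)) \o shift t) (k *: (1 : R)) - f (x + t *: d)))
    = (fun k : R => k^-1 *: ((f \o shift (x + t *: d)) (k *: d) - f (x + t *: d))).
  apply/funext => k /=; congr (_ *: (f _ - _)).
  by rewrite [k *: 1]mulr1 scalerDl addrCA.
apply: DeriveDef.
  by rewrite /derivable E; exact: diff_derivable.
by rewrite /derive E -[LHS]/('D_d f (x + t *: d)) deriveE// f_grad.
Qed.

(** Mean value theorem on [0, 1] for [psi], the difference between [f] on the segment and its linear
    term plus the quadratic bound; the Lipschitz estimate makes its derivative nonpositive. *)
Lemma descent_lemma (x z : X) :
  f z <= f x + inner (gradf x) (z - x) + L / 2 * `|z - x| ^+ 2.
Proof.
set d := z - x.
pose psi t := f (x + t *: d) - (t * inner (gradf x) d + t ^+ 2 * (L / 2 * `|d| ^+ 2)).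
pose dpsi t := inner (gradf (x + t *: d)) d - (inner (gradf x) d + t * (L * `|d| ^+ 2)).
have dP (t : R) : is_derive t (1 : R) psi (dpsi t).
  have ? := is_derive_line x d t.
  rewrite /psi /dpsi; apply: is_derive_eq.
  by rewrite /GRing.scale/=; field.
have psi_cont : {within `[0, 1], continuous psi}.
  apply: continuous_subspaceT => t.
  by apply: differentiable_continuous; apply/derivable1_diffP; exact: ex_derive.
have [c /andP[]] := MVT ltr01 (fun t _ => dP t) psi_cont.
rewrite !bnd_simp => c0 c1; rewrite subr0 mulr1 => E.
have : dpsi c <= 0.
  rewrite /dpsi opprD addrA -innerBl subr_le0.
  apply: (le_trans (inner_le _ _)).
  have := f_lip (x + c *: d) x; rewrite addrAC subrr add0r normrZ gtr0_norm// => H.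
  have -> : c * (L * `|d| ^+ 2) = L * (c * `|d|) * `|d| by ring.
  by rewrite ler_wpM2r.
have xd : x + d = z by rewrite addrC subrK.
rewrite -E /psi scale0r scale1r addr0 xd expr0n !mul0r expr1n !mul1r.
by lra.
Qed.

End Descent.

(** * The iteration *)

Section Iteration.
Context {R : realType} {X Y : euclidType R} {f : X -> R} {gradf : X -> X}.
Context {h : Y -> \bar R} {A : 'Hom(X, Y)} {AT : 'Hom(Y, X)}.
Context {L alpha delta : R} {x : nat -> X} {y : nat -> Y}.
Hypothesis f_C1 : is_C1_gradient f gradf.
Hypothesis h_gtNy : forall u, (-oo < h u)%E.
Hypothesis A_adj : is_adjoint A AT.
Hypothesis L_gt0 : 0 < L.
Hypothesis f_lip : forall u v, `|gradf u - gradf v| <= L * `|u - v|.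
Hypothesis A_surj : forall w, exists u, A u = w.
Hypothesis h_proper : proper_fun (convex_hull_fun h).
Hypothesis alpha_gt0 : 0 < alpha.
Hypothesis delta_gt0 : 0 < delta.
Hypothesis xy_PPDG : PPDG gradf h A AT alpha x y.
Local Notation g := (conjugate h).
Local Notation a := (const_a alpha delta).
Local Notation b := (const_b L alpha delta).
Local Notation c := (const_c L alpha delta).
Local Notation dx := (fun n => x n.+1 - x n).
Local Notation dg := (fun n => gradf (x n.+1) - gradf (x n)).

Lemma PPDG_dual n : alpha *: AT (y n) = x n - x n.+1 - alpha *: gradf (x n).
Proof.
have [-> _] := xy_PPDG n.
by apply: inner_ext => w; rewrite !(innerDl, innerBl, innerNl, innerZl); ring.
Qed.

Definition conj_subgrad n := A (x n.+2 + alpha *: dg n).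

(** The proximal step yields the subgradient M (y^n - y^(n+1)) + A (2 x^(n+1) - x^n); the primal
    updates at n and n + 1 express alpha A^T y through x and eliminate y. *)
Lemma conj_subgradP n : subdiff g (y n.+1) (conj_subgrad n).
Proof.
have [_ xyn] := xy_PPDG n.
have aN0 : alpha != 0 by rewrite gt_eqF.
have sym u v : inner ((alpha *: (A \o AT)%VF) u) v = inner u ((alpha *: (A \o AT)%VF) v).
  rewrite !lfunE/= !lfunE/= innerZl innerZr; congr (_ * _).
  by rewrite innerC !A_adj innerC.
have := prox_subdiff h_gtNy sym (conjugate_gtNy h_gtNy h_proper) xyn.
set p := (X in subdiff _ _ X); suff -> : p = conj_subgrad n by [].
rewrite /p addrAC linearD/= (preconditioner_invK A_adj A_surj aN0).
have -> v : (alpha *: (A \o AT)%VF) v = A (alpha *: AT v).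
  by rewrite !lfunE/= !lfunE/= linearZ.
rewrite -linearD/= linearB scalerBr !PPDG_dual /conj_subgrad; congr (A _).
by apply: inner_ext => w; rewrite !(innerDl, innerBl, innerNl, innerZl); ring.
Qed.

Definition conj_val n := fine (g (y n.+1)).

Lemma conj_valE n : g (y n.+1) = (conj_val n)%:E.
Proof. by rewrite /conj_val fineK//; case: (conj_subgradP n). Qed.

(* The value of the Lyapunov function at [iterate n]; see [Lyapunov_iterate]. *)
Definition lyap n : R :=
  f (x n.+1) + inner (y n.+1) (A (x n.+1)) - conj_val n
  - a * `|dx n.+1| ^+ 2 + b * `|dx n| ^+ 2.

Definition iterate n : X * Y * X * X := (x n.+1, y n.+1, x n.+2, x n).

Lemma Lyapunov_iterate n : Lyapunov f h A a b (iterate n) = (lyap n)%:E.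
Proof.
by rewrite /Lyapunov /= /Lagrangian conj_valE -!EFinB -EFinD /lyap distrC.
Qed.

Lemma norm_dg_le n : `|dg n| <= L * `|dx n|.
Proof. exact: f_lip. Qed.

(** Converts the dual increment of the energy estimate into primal increments, using (p + q)^2 <= 2
    p^2 + 2 q^2. *)
Lemma norm_dual_step_le n : `|alpha *: AT (y n.+2 - y n.+1)| ^+ 2 <=
  2 * `|dx n.+2| ^+ 2 + 2 * (1 + alpha * L) ^+ 2 * `|dx n.+1| ^+ 2.
Proof.
have -> : alpha *: AT (y n.+2 - y n.+1) = dx n.+1 - dx n.+2 - alpha *: dg n.+1.
  rewrite linearB scalerBr !PPDG_dual.
  by apply: inner_ext => w; rewrite !(innerDl, innerBl, innerNl, innerZl); ring.
apply: (@le_trans _ _ ((`|dx n.+2| + (1 + alpha * L) * `|dx n.+1|) ^+ 2)).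
  rewrite lerXn2r ?nnegrE//.
    by rewrite addr_ge0// mulr_ge0// addr_ge0// mulr_ge0// ltW.
  apply: (le_trans (ler_normB _ _)); rewrite normrZ gtr0_norm//.
  have := ler_normB (dx n.+1) (dx n.+2).
  have := ler_wpM2l (ltW alpha_gt0) (norm_dg_le n.+1).
  by lra.
have := sqr_ge0 (`|dx n.+2| - (1 + alpha * L) * `|dx n.+1|).
by nra.
Qed.

(** Add the descent lemma for [f] between x^(n+1) and x^(n+2) to the subgradient inequality of [g]
    between y^(n+1) and y^(n+2). The remaining cross term is split by Young's inequality. *)
Lemma lyap_decrease n : c * (`|dx n.+1| ^+ 2 + `|dx n| ^+ 2) <= lyap n - lyap n.+1.
Proof.
have desc := descent_lemma f_C1 f_lip (x n.+1) (x n.+2).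
have grad1 : inner (gradf (x n.+1)) (dx n.+1) =
    - (alpha^-1 * `|dx n.+1| ^+ 2) - inner (AT (y n.+1)) (dx n.+1).
  have -> : gradf (x n.+1) = - (alpha^-1 *: dx n.+1) - AT (y n.+1).
    rewrite -[AT _](scalerK (lt0r_neq0 alpha_gt0)) PPDG_dual.
    apply: inner_ext => w; rewrite !(innerDl, innerBl, innerNl, innerZl).
    by field; rewrite gt_eqF.
  by rewrite innerBl innerNl innerZl inner_norm.
have sub := (conj_subgradP n).2 (y n.+2).
have {}sub : conj_val n + inner (AT (y n.+2 - y n.+1)) (x n.+2 + alpha *: dg n) <= conj_val n.+1.
  by move: sub; rewrite !conj_valE -EFinD lee_fin /conj_subgrad innerC A_adj.
set w := AT (y n.+2 - y n.+1) in sub *.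
have young : - inner (alpha *: w) (dg n) <= delta / (2 * alpha) * `|alpha *: w| ^+ 2
    + alpha / (2 * delta) * `|dg n| ^+ 2.
  have := @inner_young R X (alpha *: w) (dg n) (delta / alpha) (divr_gt0 delta_gt0 alpha_gt0).
  move=> /le_trans; apply; rewrite le_eqVlt; apply/orP; left; apply/eqP.
  by field; rewrite !gt_eqF.
have dgL : `|dg n| ^+ 2 <= L ^+ 2 * `|dx n| ^+ 2.
  by rewrite -exprMn lerXn2r ?nnegrE ?mulr_ge0 ?(ltW L_gt0)// norm_dg_le.
have k1 : 0 <= delta / (2 * alpha) by rewrite divr_ge0 ?mulr_ge0 ?ltW.
have k2 : 0 <= alpha / (2 * delta) by rewrite divr_ge0 ?mulr_ge0 ?ltW.
have := ler_wpM2l k1 (norm_dual_step_le n); rewrite -/w => dual.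
have {}dgL := ler_wpM2l k2 dgL.
(* The two terms cancel against [sub] and [grad1] respectively. *)
have wE : inner (y n.+2) (A (x n.+2)) - inner (y n.+1) (A (x n.+1)) =
    inner w (x n.+2) + inner (AT (y n.+1)) (dx n.+1).
  by rewrite !A_adj /w linearB innerBl innerBr; ring.
rewrite innerZl in young.
rewrite innerDr innerZr in sub.
set D2 := `|dx n.+2| ^+ 2 in dual *; set D1 := `|dx n.+1| ^+ 2 in dual grad1 desc *.
set D0 := `|dx n| ^+ 2 in dgL *.
have main : lyap n.+1 - lyap n <= - (alpha^-1 * D1) + L / 2 * D1
   + delta / (2 * alpha) * (2 * D2 + 2 * (1 + alpha * L) ^+ 2 * D1)
   + alpha / (2 * delta) * (L ^+ 2 * D0) - a * D2 + a * D1 + b * D1 - b * D0.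
  by rewrite /lyap -/D2 -/D1 -/D0; lra.
(* The choice of [a] cancels [D2], and that of [b] gives [D1] and [D0] the same coefficient -c. *)
have -> : c * (D1 + D0) = - (- (alpha^-1 * D1) + L / 2 * D1
   + delta / (2 * alpha) * (2 * D2 + 2 * (1 + alpha * L) ^+ 2 * D1)
   + alpha / (2 * delta) * (L ^+ 2 * D0) - a * D2 + a * D1 + b * D1 - b * D0).
  by rewrite /const_c /const_b /const_a; field; rewrite !gt_eqF.
by lra.
Qed.


(** * Limit of the energy, critical cluster points and the KL inequality *)

Hypothesis a_ge0 : 0 <= a.
Hypothesis b_gt0 : 0 < b.
Hypothesis c_gt0 : 0 < c.

Lemma lyap_nonincreasing : nonincreasing_seq lyap.
Proof.
apply/nonincreasing_seqP => n; rewrite -subr_ge0; apply: le_trans (lyap_decrease n).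
by rewrite mulr_ge0 ?(ltW c_gt0)// addr_ge0 ?sqr_ge0.
Qed.

(** The descent lemma from x^(n+1) to 0 bounds [f] below. The subgradients [conj_subgrad n] are
    bounded, so the subgradient inequality tested at y^1 bounds [conj_val n] above. *)
Lemma lyap_lbounded {B : R} : (forall n, `|x n| <= B) -> (forall n, `|y n| <= B) ->
  has_lbound (range lyap).
Proof.
move=> xB yB; have [C C0 HC] := linear_bounded_euclid A.
have B0 : 0 <= B by exact: le_trans (xB 0%N).
have dxB n : `|dx n| <= 2 * B.
  by apply: (le_trans (ler_normB _ _)); have := xB n; have := xB n.+1; lra.
have gradB n : `|gradf (x n)| <= `|gradf 0| + L * B.
  have := f_lip (x n) 0; rewrite subr0 => H.
  have -> : gradf (x n) = gradf 0 + (gradf (x n) - gradf 0) by rewrite addrC subrK.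
  apply: (le_trans (ler_normD _ _)); rewrite lerD2l; apply: (le_trans H).
  by rewrite ler_wpM2l// ltW.
set Gb := `|gradf 0| + L * B in gradB.
have Gb0 : 0 <= Gb by exact: le_trans (gradB 0%N).
pose P := C * (B + alpha * (L * (2 * B))).
have P0 : 0 <= P.
  by rewrite mulr_ge0// addr_ge0// mulr_ge0 ?(ltW alpha_gt0)// mulr_ge0 ?(ltW L_gt0)// mulr_ge0.
have pB n : `|conj_subgrad n| <= P.
  apply: (le_trans (HC _)); rewrite ler_wpM2l//.
  apply: (le_trans (ler_normD _ _)); rewrite lerD// normrZ gtr0_norm//.
  rewrite ler_wpM2l ?(ltW alpha_gt0)//; apply: (le_trans (norm_dg_le n)).
  by rewrite ler_wpM2l// ltW.
exists (f 0 - Gb * B - L / 2 * B ^+ 2 - B * (C * B) - (conj_val 0 + P * (2 * B)) - a * (2 * B) ^+ 2).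
move=> _ [n _ <-]; rewrite /lyap.
have H1 : f 0 <= f (x n.+1) + Gb * B + L / 2 * B ^+ 2.
  have := descent_lemma f_C1 f_lip (x n.+1) 0; rewrite sub0r => /le_trans; apply.
  rewrite normrN -!addrA lerD2l; apply: lerD.
    apply: (le_trans (inner_le _ _)); rewrite normrN.
    by rewrite ler_pM.
  by rewrite ler_wpM2l ?divr_ge0 ?(ltW L_gt0)// lerXn2r ?nnegrE.
have H2 : - (B * (C * B)) <= inner (y n.+1) (A (x n.+1)).
  rewrite lerNl; apply: (le_trans (ler_norm _)); rewrite normrN.
  apply: (le_trans (norm_inner_le _ _)); rewrite ler_pM//.
  by apply: (le_trans (HC _)); rewrite ler_wpM2l.
have H3 : conj_val n <= conj_val 0 + P * (2 * B).
  have := (conj_subgradP n).2 (y 1); rewrite !conj_valE -EFinD lee_fin.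
  have : - inner (conj_subgrad n) (y 1 - y n.+1) <= P * (2 * B).
    apply: (le_trans (ler_norm _)); rewrite normrN.
    apply: (le_trans (norm_inner_le _ _)); rewrite ler_pM//.
    by apply: (le_trans (ler_normB _ _)); have := yB 1; have := yB n.+1; lra.
  by lra.
have H4 : a * `|dx n.+1| ^+ 2 <= a * (2 * B) ^+ 2.
  by rewrite ler_wpM2l// lerXn2r ?nnegrE ?mulr_ge0.
have H5 : 0 <= b * `|dx n| ^+ 2 by rewrite mulr_ge0 ?sqr_ge0// ltW.
by lra.
Qed.

Lemma step_cvg0 {l : R} : lyap @ \oo --> l -> (`|dx n|) @[n --> \oo] --> 0.
Proof.
move=> ll.
have dl : (lyap n - lyap n.+1) @[n --> \oo] --> 0.
  rewrite -(subrr l); apply: cvgB => //.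
  by rewrite cvg_shiftS.
apply/cvgr0Pnorm_lt => e e0.
have e'0 : 0 < c * e ^+ 2 by rewrite mulr_gt0// exprn_gt0.
have /cvgr0Pnorm_lt/(_ _ e'0) := dl; apply: filterS => n /(le_lt_trans (ler_norm _)).
move=> /(le_lt_trans (lyap_decrease n)); rewrite ltr_pM2l// => H.
rewrite normr_id -(@ltr_pXn2r _ 2) ?nnegrE ?(ltW e0)//.
by have := sqr_ge0 `|dx n.+1|; lra.
Qed.


(** Vanishing steps make neighbouring iterates share their limit along a subsequence, and closedness
    of the subdifferential graph passes both the energy and its subgradients to that limit. *)
Lemma cluster_point_critical {B l : R} :
  (forall n, `|x n| <= B) -> (forall n, `|y n| <= B) -> lyap @ \oo --> l ->
  exists (phi : nat -> nat) (xbar : X) (ybar : Y),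
    [/\ forall n, (n <= phi n)%N, x (phi n).+1 @[n --> \oo] --> xbar,
        AT ybar = - gradf xbar,
        Lyapunov f h A a b (xbar, ybar, xbar, xbar) = l%:E &
        dom_sub (Lyapunov_sub gradf h A AT a b) (xbar, ybar, xbar, xbar)].
Proof.
move=> xB yB ll.
have [phi1 [xbar [phi1_ge x1]]] := bounded_seq_cluster (fun n => xB n.+1).
have [phi2 [ybar [phi2_ge y1]]] := bounded_seq_cluster (fun n => yB (phi1 n).+1).
pose phi n := phi1 (phi2 n).
have phi_ge n : (n <= phi n)%N := leq_trans (phi2_ge n) (phi1_ge (phi2 n)).
have xl : x (phi n).+1 @[n --> \oo] --> xbar by exact: (cvg_subseq phi2_ge x1).
have yl : y (phi n).+1 @[n --> \oo] --> ybar by exact: y1.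
have d0n : `|dx (phi n)| @[n --> \oo] --> 0 := cvg_subseq phi_ge (step_cvg0 ll).
have d1n : `|dx (phi n).+1| @[n --> \oo] --> 0.
  have := step_cvg0 ll; rewrite -(cvg_shiftS (fun n => `|dx n|)).
  exact: (cvg_subseq phi_ge).
have d0 : dx (phi n) @[n --> \oo] --> (0 : X) by exact/norm_cvg0P.
have d1 : dx (phi n).+1 @[n --> \oo] --> (0 : X) by exact/norm_cvg0P.
have gl : gradf (x (phi n).+1) @[n --> \oo] --> gradf xbar.
  by apply: (cvg_comp _ _ xl); exact: f_C1.2.
have dgl : dg (phi n) @[n --> \oo] --> (0 : X).
  apply/norm_cvg0P.
  apply: (@squeeze_cvgr _ _ _ _ (fun=> 0) (fun n => L * `|dx (phi n)|)).
  - by near=> n; rewrite normr_ge0 norm_dg_le.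
  - exact: cvg_cst.
  - by rewrite -(mulr0 L); apply: cvgM => //; exact: cvg_cst.
have fl : f (x (phi n).+1) @[n --> \oo] --> f xbar.
  apply: (cvg_comp _ _ xl); apply: differentiable_continuous.
  exact: (f_C1.1 xbar).1.
have pl : conj_subgrad (phi n) @[n --> \oo] --> A xbar.
  have -> : A xbar = A ((xbar + 0) + alpha *: 0) by rewrite scaler0 !addr0.
  apply: hom_cvg; apply: cvgD.
    have -> : (fun n => x (phi n).+2) = (fun n => x (phi n).+1 + dx (phi n).+1).
      by apply/funext => n; rewrite addrC subrK.
    exact: cvgD.
  by apply: cvgZl_tmp.
(* Although [g] is only lower semicontinuous, its values converge here: the energy and all its other
   terms do. *)
have cl : conj_val (phi n) @[n --> \oo] --> f xbar + inner ybar (A xbar) - l.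
  have -> : f xbar + inner ybar (A xbar) - l =
    f xbar + inner ybar (A xbar) - a * 0 ^+ 2 + b * 0 ^+ 2 - l by rewrite expr0n/= !mulr0 addr0 subr0.
  have -> : (fun n => conj_val (phi n)) = (fun n => f (x (phi n).+1) + inner (y (phi n).+1) (A (x (phi n).+1))
    - a * `|dx (phi n).+1| ^+ 2 + b * `|dx (phi n)| ^+ 2 - lyap (phi n)).
    by apply/funext => n; rewrite /lyap; ring.
  have sq (u : nat -> R) (m : R) : u @ \oo --> m -> (u n ^+ 2) @[n --> \oo] --> m ^+ 2.
    by move=> um; rewrite expr2; under eq_fun do rewrite expr2; exact: cvgM.
  apply: cvgB; last exact: (cvg_subseq phi_ge ll).
  apply: cvgD; last by apply: cvgM; [exact: cvg_cst|exact: sq].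
  apply: cvgB; last by apply: cvgM; [exact: cvg_cst|exact: sq].
  by apply: cvgD => //; apply: inner_cvg => //; exact: hom_cvg.
have [gE gsub] := subdiff_conjugate_closed h_gtNy yl pl cl
  (fun n => conj_valE (phi n)) (fun n => conj_subgradP (phi n)).
exists phi, xbar, ybar; split=> //.
- apply: (@norm_cvg_unique _ _ (AT (y (phi n).+1) @[n --> \oo])); first exact: hom_cvg.
  have -> : (fun n => AT (y (phi n).+1)) =
    (fun n => - (alpha^-1 *: dx (phi n).+1) - gradf (x (phi n).+1)).
    apply/funext => n; rewrite -[AT _](scalerK (lt0r_neq0 alpha_gt0)) PPDG_dual.
    apply: inner_ext => w; rewrite !(innerDl, innerBl, innerNl, innerZl).
    by field; rewrite gt_eqF.
  have -> : - gradf xbar = - (alpha^-1 *: (0 : X)) - gradf xbar.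
    by rewrite scaler0 oppr0 add0r.
  apply: cvgB => //; apply: cvgN; exact: cvgZl_tmp.
- rewrite /Lyapunov /Lagrangian gE subrr normr0 expr0n/= !mulr0 -!EFinB -EFinD.
  by congr EFin; ring.
(* The dual component uses [A xbar], the limit of the subgradients, as element of the
   subdifferential of [g] at [ybar]. *)
- exists (gradf xbar + AT ybar - (2 * a) *: (xbar - xbar) + (2 * b) *: (xbar - xbar),
    A xbar - A xbar, (2 * a) *: (xbar - xbar), (2 * b) *: (xbar - xbar)).
  by split=> //; split=> //; split=> //; exists (A xbar).
Unshelve. all: by end_near. Qed.

Lemma dual_dist_le {lambda : R} {xbar : X} {ybar : Y} :
  is_min_eigenvalue (A \o AT)%VF lambda -> AT ybar = - gradf xbar ->
  forall n, `|y n - ybar| <= (alpha^-1 * `|dx n| + L * `|x n - xbar|) / Num.sqrt lambda.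
Proof.
move=> lmin ATy n; have l0 := min_eigenvalue_gt0 A_adj A_surj lmin.
rewrite ler_pdivlMr ?sqrtr_gt0// mulrC.
apply: (le_trans (adjoint_norm_ge A_adj (ltW l0) lmin _)).
have -> : AT (y n - ybar) = - (alpha^-1 *: dx n) - (gradf (x n) - gradf xbar).
  rewrite [LHS]linearB/= ATy -[AT (y n)](scalerK (lt0r_neq0 alpha_gt0)) PPDG_dual.
  apply: inner_ext => w; rewrite !(innerDl, innerBl, innerNl, innerZl).
  by field; rewrite gt_eqF.
apply: (le_trans (ler_normB _ _)).
by rewrite normrN normrZ gtr0_norm ?invr_gt0// lerD2l.
Qed.

(** With the subgradient [conj_subgrad n], the primal update turns every component into a
    combination of [dx n], [dx n.+1] and [dg n]. *)
Lemma dist0_Lyapunov_sub_le : exists2 C : R, 0 < C & forall n,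
  (dist0 (@prod_norm R X Y) (Lyapunov_sub gradf h A AT a b (iterate n))
   <= (C * (`|dx n| + `|dx n.+1|))%:E)%E.
Proof.
have [C C0 HC] := linear_bounded_euclid A.
(* The sum of the coefficients of [|dx n|] and [|dx n.+1|] over the four components. *)
exists (alpha^-1 + 4 * a + 4 * b + C * (1 + alpha * L)).
  have : 0 < alpha^-1 by rewrite invr_gt0.
  have : 0 <= C * (1 + alpha * L) by rewrite mulr_ge0// addr_ge0// mulr_ge0// ltW.
  by have := a_ge0; have := b_gt0; lra.
move=> n.
pose w1 := gradf (x n.+1) + AT (y n.+1) - (2 * a) *: (x n.+1 - x n.+2) + (2 * b) *: (x n.+1 - x n).
pose w2 := A (x n.+1) - conj_subgrad n.
pose w3 := (2 * a) *: (x n.+1 - x n.+2).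
pose w4 := (2 * b) *: (x n - x n.+1).
have wsub : Lyapunov_sub gradf h A AT a b (iterate n) (w1, w2, w3, w4).
  split=> //; split=> //; split=> //.
  by exists (conj_subgrad n) => //; exact: conj_subgradP.
apply: (@le_trans _ _ (prod_norm (w1, w2, w3, w4))%:E).
  by apply: ereal_inf_lbound; exists (w1, w2, w3, w4).
rewrite lee_fin.
have b0 := ltW b_gt0.
have n3 : `|w3| = 2 * a * `|dx n.+1|.
  by rewrite normrZ distrC ger0_norm// mulr_ge0.
have n4 : `|w4| = 2 * b * `|dx n|.
  by rewrite normrZ distrC ger0_norm// mulr_ge0.
have n1 : `|w1| <= alpha^-1 * `|dx n.+1| + 2 * a * `|dx n.+1| + 2 * b * `|dx n|.
  have -> : w1 = - (alpha^-1 *: dx n.+1) - w3 - w4.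
    rewrite /w1 /w3 /w4 -[AT (y _)](scalerK (lt0r_neq0 alpha_gt0)) PPDG_dual.
    apply: inner_ext => w; rewrite !(innerDl, innerBl, innerNl, innerZl).
    by field; rewrite gt_eqF.
  have := ler_normB (- (alpha^-1 *: dx n.+1) - w3) w4.
  have := ler_normB (- (alpha^-1 *: dx n.+1)) w3.
  by rewrite n3 n4 normrN normrZ gtr0_norm ?invr_gt0//; lra.
have n2 : `|w2| <= C * (`|dx n.+1| + alpha * (L * `|dx n|)).
  have -> : w2 = - A (dx n.+1 + alpha *: dg n).
    rewrite /w2 /conj_subgrad -linearB -linearN; congr (A _).
    by apply: inner_ext => w; rewrite !(innerDl, innerBl, innerNl, innerZl); ring.
  rewrite normrN; apply: (le_trans (HC _)); rewrite ler_wpM2l//.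
  apply: (le_trans (ler_normD _ _)); rewrite lerD2l normrZ gtr0_norm//.
  by rewrite ler_pM2l// norm_dg_le.
apply: (@le_trans _ _ (`|w1| + `|w2| + `|w3| + `|w4|)).
  rewrite /prod_norm -[leRHS]ger0_norm ?addr_ge0// -sqrtr_sqr ler_wsqrtr//.
  have := normr_ge0 w1; have := normr_ge0 w2; have := normr_ge0 w3; have := normr_ge0 w4.
  by nra.
have i0 : 0 <= alpha^-1 * `|dx n| by rewrite mulr_ge0// invr_ge0 ltW.
have i1 : 0 <= C * (alpha * L) * `|dx n.+1|.
  by rewrite !mulr_ge0 ?(ltW L_gt0) ?(ltW alpha_gt0).
have i2 := mulr_ge0 C0 (normr_ge0 (dx n)).
have i3 := mulr_ge0 a_ge0 (normr_ge0 (dx n)).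
have i4 := mulr_ge0 b0 (normr_ge0 (dx n.+1)).
rewrite n3 n4; nra.
Qed.

(** Closeness of x^(n+1) to [xbar] alone puts the whole point [iterate n] in the KL neighbourhood:
    the other x-components differ by vanishing steps, and y is controlled by [dual_dist_le]. *)
Lemma KL_iterates {theta l lambda : R} {xbar : X} {ybar : Y} : theta < 1 ->
  KL_exponent (@prod_norm R X Y) (Lyapunov f h A a b)
    (Lyapunov_sub gradf h A AT a b) theta ->
  is_min_eigenvalue (A \o AT)%VF lambda ->
  lyap @ \oo --> l -> AT ybar = - gradf xbar ->
  Lyapunov f h A a b (xbar, ybar, xbar, xbar) = l%:E ->
  dom_sub (Lyapunov_sub gradf h A AT a b) (xbar, ybar, xbar, xbar) ->
  exists (K eps : R) (N : nat), [/\ 0 < K, 0 < eps &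
    forall n, (N <= n)%N -> `|x n.+1 - xbar| < eps -> 0 < lyap n - l ->
      1 <= K * (lyap n - l) `^ (- theta) * (`|dx n| + `|dx n.+1|)].
Proof.
move=> th1 KL lmin ll ATy Lz domz.
have [sigma s0 [eta [U [eta0 nU _ HU]]]] := KL _ domz.
have [C C0 HC] := dist0_Lyapunov_sub_le.
have lam0 : 0 < Num.sqrt lambda.
  by rewrite sqrtr_gt0; exact: (min_eigenvalue_gt0 A_adj A_surj lmin).
have /nbhs_ballP[e0 /= e0P ballU] := nU.
have aL : 0 < alpha^-1 + L by rewrite addr_gt0// invr_gt0.
(* Half of [e0] leaves room for one step in the x-components; the second bound serves the
   y-component. *)
pose eps := Num.min (e0 / 2) (e0 * Num.sqrt lambda / (alpha^-1 + L)).
have eps0 : 0 < eps by rewrite lt_min !divr_gt0// mulr_gt0.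
have eps1 : eps <= e0 / 2 by rewrite ge_min lexx.
have eps2 : (alpha^-1 + L) * eps <= e0 * Num.sqrt lambda.
  by rewrite mulrC -ler_pdivlMr// ge_min lexx orbT.
have [N1 _ HN1] := (cvgr0Pnorm_lt _).1 (step_cvg0 ll) _ eps0.
have dN n : (N1 <= n)%N -> `|dx n| < eps by move=> /HN1 /=; rewrite normr_id.
have rl : (lyap n - l) @[n --> \oo] --> 0.
  by rewrite -(subrr l); apply: cvgB => //; exact: cvg_cst.
have [N2 HN2] : exists N2, forall n, (N2 <= n)%N -> ((lyap n - l)%:E < eta)%E.
  case: eta eta0 {HU} => [et|_|//]; last by exists 0%N => n _; rewrite ltry.
  rewrite lte_fin => et0; have [N2 _ H] := (cvgr0Pnorm_lt _).1 rl _ et0.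
  by exists N2 => n /H /(le_lt_trans (ler_norm _)); rewrite lte_fin.
(* The factor sigma (1 - theta) comes from the derivative of the desingularizing function, [C] from
   the subgradient bound. *)
exists (sigma * (1 - theta) * C), eps, (maxn N1 N2); split=> //.
  by rewrite !mulr_gt0// subr_gt0.
move=> n; rewrite geq_max => /andP[n1 n2] xn rn.
have Un : U (iterate n).
  apply: ballU; split; [split; [split|]|] => /=; rewrite -ball_normE /= distrC.
  - by lra.
  - apply: (le_lt_trans (dual_dist_le lmin ATy n.+1)).
    rewrite ltr_pdivrMr//; apply: lt_le_trans eps2.
    have := dN n.+1 (leqW n1) => H; rewrite mulrDl.
    by rewrite ltrD// ltr_pM2l// ?invr_gt0.
  - have -> : x n.+2 - xbar = dx n.+1 + (x n.+1 - xbar) by rewrite addrA subrK.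
    have := ler_normD (dx n.+1) (x n.+1 - xbar); have := dN n.+1 (leqW n1).
    by lra.
  - have -> : x n - xbar = - dx n + (x n.+1 - xbar) by rewrite opprB addrA subrK.
    have := ler_normD (- dx n) (x n.+1 - xbar); have := dN n n1; rewrite normrN.
    by lra.
have := HU _ Un; rewrite Lyapunov_iterate Lz -EFinB lte_fin rn HN2// => /(_ isT).
have pE : 1 - theta - 1 = - theta by ring.
rewrite /= derive1_scaled_powR// pE => H.
set k := sigma * (1 - theta) * _ in H.
have k0 : 0 <= k by rewrite !mulr_ge0 ?powR_ge0 ?(ltW s0)// subr_ge0 ltW.
rewrite -lee_fin; apply: (le_trans H).
have k0' : (0 <= k%:E)%E by rewrite lee_fin.
apply: (le_trans (lee_wpmul2l k0' (HC n))).
by rewrite -EFinM lee_fin /k le_eqVlt; apply/orP; left; apply/eqP; ring.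
Qed.


(** Reduces all three rates to one scalar sequence, the energy gap [r]. *)
Lemma PPDG_error_bound {theta lambda : R} : 0 <= theta < 1 ->
  bounded_set (range (fun k => (x k, y k))) ->
  KL_exponent (@prod_norm R X Y) (Lyapunov f h A a b)
    (Lyapunov_sub gradf h A AT a b) theta ->
  is_min_eigenvalue (A \o AT)%VF lambda ->
  exists (xbar : X) (ybar : Y) (r : nat -> R) (D kappa : R) (N : nat),
    [/\ 0 < D /\ 0 < kappa, nonincreasing_seq r /\ (forall n, 0 <= r n),
      r @ \oo --> 0,
      forall n, (N <= n)%N -> 0 < r n -> kappa * r n `^ (2 * theta) <= r n - r n.+1 &
      forall n, (N <= n)%N -> `|x n.+1 - xbar| <= D * r n `^ (1 - theta) /\
        `|y n.+1 - ybar| <= D * r n `^ (1 - theta) * (alpha^-1 + L) / Num.sqrt lambda].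
Proof.
move=> th01 [B0 [_ HB]] KL lmin; have /andP[th0 th1] := th01.
have xyB n : `|(x n, y n)| <= B0 + 1 by apply: HB; [rewrite ltrDl|exists n].
have xB n : `|x n| <= B0 + 1 by apply: le_trans (xyB n); rewrite prod_normE le_max lexx.
have yB n : `|y n| <= B0 + 1 by apply: le_trans (xyB n); rewrite prod_normE le_max lexx orbT.
have := nonincreasing_cvgn lyap_nonincreasing (lyap_lbounded xB yB).
set l := inf _ => ll.
have lyap_ge n : l <= lyap n.
  by rewrite -(cvg_lim (@Rhausdorff R) ll); apply: nonincreasing_cvgn_ge;
    [exact: lyap_nonincreasing|apply: cvgP ll].
have [phi [xbar [ybar [phi_ge xl ATy Lz domz]]]] := cluster_point_critical xB yB ll.
have [K [eps [N [K0 eps0 KLn]]]] := KL_iterates th1 KL lmin ll ATy Lz domz.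
pose r n := lyap n - l.
have r0 n : 0 <= r n by rewrite subr_ge0.
have rcvg : r @ \oo --> 0.
  by rewrite -(subrr l); apply: cvgB => //; exact: cvg_cst.
pose e n := `|dx n| + `|dx n.+1|.
have e0 n : 0 <= e n by rewrite addr_ge0.
have c2 : 0 < c / 2 by rewrite divr_gt0.
(* The factor 1/2 pays for replacing the sum of squares by the square of the sum. *)
have dec n : c / 2 * e n ^+ 2 <= r n - r n.+1.
  apply: (@le_trans _ _ (lyap n - lyap n.+1)); last by rewrite /r; lra.
  apply: (le_trans _ (lyap_decrease n)); rewrite -mulrA ler_pM2l// /e.
  by have := sqr_ge0 (`|dx n| - `|dx n.+1|); lra.
have cth : 0 < c / 2 * (1 - theta) by rewrite mulr_gt0// subr_gt0.
pose D := K / (c / 2 * (1 - theta)).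
have D0 : 0 < D by rewrite divr_gt0.
pose T n := D * r n `^ (1 - theta).
have T0 n : 0 <= T n by rewrite mulr_ge0 ?powR_ge0// ltW.
have Tcvg : T @ \oo --> 0.
  rewrite -(mulr0 D); apply: cvgM; first exact: cvg_cst.
  by apply: powR_cvg_to0 => //; rewrite subr_gt0.
have eT n : (N <= n)%N -> `|x n.+1 - xbar| < eps -> e n <= T n - T n.+1.
  move=> Nn xn; have := KL_length_le th01 c2 (ltW K0) (r0 n) (r0 n.+1) (e0 n) (dec n) (KLn n Nn xn).
  have -> : T n - T n.+1 =
    K * (r n `^ (1 - theta) - r n.+1 `^ (1 - theta)) / (c / 2 * (1 - theta)).
    by rewrite /T /D -mulrBr mulrAC.
  by rewrite ler_pdivlMr// [e n * _]mulrC.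
(* The sequence is shifted because the KL inequality at index n is conditioned on x^(n+1) being near
   [xbar]. *)
have [||_ [K1 HK1]] := cvg_of_local_length_bound eps0 T0 Tcvg (x := fun n => x n.+1) (N := N) (xbar := xbar).
- move=> t M t0; have [N1 _ HN1] := (cvgrPdist_lt _ _).1 xl _ t0.
  exists (phi (maxn M N1)).
    by apply: leq_trans (phi_ge _); exact: leq_maxl.
  by rewrite distrC; apply: HN1; exact: leq_maxr.
- move=> n Nn xn; apply: le_trans (eT n Nn xn).
  by rewrite lerDr.
exists xbar, ybar, r, D, (c / 2 / K ^+ 2), (maxn N K1); split=> //.
- by split=> //; rewrite divr_gt0// exprn_gt0.
- by split=> // m n mn; rewrite lerD2r; exact: lyap_nonincreasing.
- move=> n; rewrite geq_max => /andP[Nn Kn] rn.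
  by apply: (KL_decrease_ge c2 K0 rn (e0 n) (dec n)); apply: KLn => //; case: (HK1 n Kn).
- move=> n; rewrite geq_max => /andP[Nn Kn].
  have [xn xT] := HK1 n Kn; split=> //.
  apply: (le_trans (dual_dist_le lmin ATy n.+1)).
  (* Both [|dx n.+1|], as part of [e n], and [|x n.+1 - xbar|] are at most [T n]; hence the factor
     1/alpha + L. *)
  rewrite ler_wpM2r ?invr_ge0 ?sqrtr_ge0// mulrDr lerD//.
    rewrite mulrC ler_wpM2r ?invr_ge0 ?(ltW alpha_gt0)//.
    have := eT n Nn xn; rewrite /e -/(T n).
    by have := normr_ge0 (dx n); have := T0 n.+1; lra.
  by rewrite mulrC ler_wpM2r ?(ltW L_gt0).
Qed.

End Iteration.

(** * From the scalar recursion to the rates of the iterates *)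

Theorem theorem2p10 (R : realType) (X Y : euclidType R)
  (f : X -> R) (gradf : X -> X) (h : Y -> \bar R)
  (A : 'Hom(X, Y)) (AT : 'Hom(Y, X)) (L alpha delta theta lambda : R)
  (x : nat -> X) (y : nat -> Y)
  (f_C1 : is_C1_gradient f gradf)
  (h_gtNy : forall u, (-oo < h u)%E)
  (A_adj : is_adjoint A AT)
  (A1 : 0 < L /\ forall u v, `|gradf u - gradf v| <= L * `|u - v|)
  (A2 : forall w, (conjugate h w < +oo)%E ->
     (-oo < ereal_inf [set Lagrangian f h A u w | u in [set: X]])%E)
  (A3 : forall w, exists u, A u = w)
  (A4 : proper_fun (convex_hull_fun h))
  (alpha_gt0 : 0 < alpha) (delta_gt0 : 0 < delta)
  (a_gt0 : 0 < const_a alpha delta)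
  (b_gt0 : 0 < const_b L alpha delta)
  (c_gt0 : 0 < const_c L alpha delta)
  (xy_PPDG : PPDG gradf h A AT alpha x y)
  (xy_bounded : bounded_set (range (fun k => (x k, y k))))
  (theta_ge0 : 0 <= theta) (theta_lt1 : theta < 1)
  (Lyapunov_KL :
     KL_exponent (@prod_norm R X Y)
       (Lyapunov f h A (const_a alpha delta) (const_b L alpha delta))
       (Lyapunov_sub gradf h A AT
          (const_a alpha delta) (const_b L alpha delta))
       theta)
  (lambda_min : is_min_eigenvalue (A \o AT)%VF lambda) :
  let lambdahat := Num.sqrt lambda in
  exists (xbar : X) (ybar : Y),
    (x @ \oo --> xbar) /\ (y @ \oo --> ybar) /\
    (theta = 0 ->
       exists K : nat, forall k, (K <= k)%N -> x k = xbar /\ y k = ybar) /\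
    (0 < theta <= 2^-1 ->
       exists (nu tau : R) (K : nat),
         [/\ 0 < nu, 0 < tau < 1, (0 < K)%N &
           let nu' := nu * (alpha^-1 + L) / lambdahat in
           forall k, (K <= k)%N ->
             `|x k - xbar| <= nu * tau ^+ (k - K) /\
             `|y k - ybar| <= nu' * tau ^+ (k - K)]) /\
    (2^-1 < theta < 1 ->
       exists (mu : R) (K : nat),
         [/\ 0 < mu, (0 < K)%N &
           let mu' := mu * (alpha^-1 + L) / lambdahat in
           let r := - ((1 - theta) / (2 * theta - 1)) in
           forall k, (K <= k)%N ->
             `|x k - xbar| <= mu * k%:R `^ r /\
             `|y k - ybar| <= mu' * k%:R `^ r]).
Proof.
move=> lambdahat; have [L_gt0 f_lip] := A1.
have th01 : 0 <= theta < 1 by rewrite theta_ge0.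
have [xbar [ybar [r [D [kappa [N]]]]]] := PPDG_error_bound f_C1 h_gtNy A_adj
  L_gt0 f_lip A3 A4 alpha_gt0 delta_gt0 xy_PPDG (ltW a_gt0) b_gt0 c_gt0 th01
  xy_bounded Lyapunov_KL lambda_min.
rewrite -/lambdahat => -[[D0 kappa0] [r_dec r_ge0] r_cvg r_rec bnd].
pose kap := (alpha^-1 + L) / lambdahat.
have kap0 : 0 <= kap.
  by rewrite divr_ge0 ?sqrtr_ge0// addr_ge0 ?invr_ge0 ?(ltW alpha_gt0) ?(ltW L_gt0).
have bndx n : (N <= n)%N -> `|x n.+1 - xbar| <= D * r n `^ (1 - theta).
  by move=> /bnd[].
have bndy n : (N <= n)%N -> `|y n.+1 - ybar| <= D * r n `^ (1 - theta) * kap.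
  by move=> /bnd[_]; rewrite -mulrA.
have T_cvg : (D * r n `^ (1 - theta)) @[n --> \oo] --> 0.
  rewrite -(mulr0 D); apply: cvgM; first exact: cvg_cst.
  by apply: powR_cvg_to0 => //; rewrite subr_gt0.
exists xbar, ybar; split; [|split; [|split; [|split]]].
- rewrite -cvg_shiftS; apply/subr_cvg0/norm_cvg0P.
  apply: (@squeeze_cvgr _ _ _ _ (fun=> 0)) T_cvg; last exact: cvg_cst.
  by exists N => // n /= Nn; rewrite normr_ge0 bndx.
- rewrite -cvg_shiftS; apply/subr_cvg0/norm_cvg0P.
  have Tk_cvg : (D * r n `^ (1 - theta) * kap) @[n --> \oo] --> 0.
    by rewrite -(mul0r kap); apply: cvgM => //; exact: cvg_cst.
  apply: (@squeeze_cvgr _ _ _ _ (fun=> 0)) Tk_cvg; last exact: cvg_cst.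
  by exists N => // n /= Nn; rewrite normr_ge0 bndy.
- move=> th0; have [K HK] := finite_decay r_ge0 r_dec r_cvg kappa0 r_rec th0.
  (* The successor reflects that [r n] controls the iterate of index n + 1; the same shift recurs in
     the other two cases. *)
  exists (maxn N K).+1 => -[//|n]; rewrite ltnS geq_max => /andP[Nn Kn].
  have := bndy n Nn; have := bndx n Nn.
  rewrite HK// powR0 ?mulr0 ?mul0r; last by rewrite gt_eqF ?subr_gt0.
  by rewrite !normr_le0 !subr_eq0 => /eqP -> /eqP ->.
- move=> th; have [q [K [/andP[q0 q1] NK HK]]] := linear_decay r_ge0 r_dec r_cvg kappa0 r_rec th.
  (* Errors scale like r^(1 - theta), hence [tau]; the added 1 keeps [nu] positive when [r K]
     vanishes. *)
  pose nu := D * r K `^ (1 - theta) + 1; pose tau := q `^ (1 - theta).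
  have th' : 0 < 1 - theta by rewrite subr_gt0.
  have w0 : 0 <= D * r K `^ (1 - theta) by rewrite mulr_ge0 ?powR_ge0// ltW.
  have tau0 : 0 < tau by rewrite powR_gt0.
  exists nu, tau, K.+1; split=> //.
  + by rewrite ltr_wpDl.
  + rewrite tau0/=; have -> : 1 = 1 `^ (1 - theta) by rewrite powR1.
    by rewrite gt0_ltr_powR// nnegrE ltW.
  move=> nu' -[//|n]; rewrite ltnS subSS => Kn.
  have le_nu : D * r n `^ (1 - theta) <= nu * tau ^+ (n - K).
    have := HK (n - K)%N; rewrite subnKC// => H.
    apply: (@le_trans _ _ (D * (r K `^ (1 - theta) * tau ^+ (n - K)))).
      rewrite ler_pM2l//.
      rewrite -powR_exprn ?(ltW q0)//.
      rewrite -powRM ?exprn_ge0 ?(ltW q0)//.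
      by apply: ge0_ler_powR => //; rewrite ?nnegrE ?(ltW th')// mulr_ge0 ?exprn_ge0 ?(ltW q0).
    rewrite mulrA ler_wpM2r ?exprn_ge0 ?(ltW tau0)//.
    by rewrite lerDl.
  have Nn := leq_trans NK Kn; split; first exact: le_trans (bndx n Nn) le_nu.
  apply: (le_trans (bndy n Nn)); rewrite /nu' -[nu * _ / _]mulrA -/kap [leRHS]mulrAC.
  by rewrite ler_wpM2r.
- move=> th; have [C [K [C0 NK HK]]] := polynomial_decay r_ge0 r_dec kappa0 r_rec th.
  exists (D * C), K.+1; split=> //; first by rewrite mulr_gt0.
  move=> mu' s -[//|n]; rewrite ltnS => Kn.
  have le_mu : D * r n `^ (1 - theta) <= D * C * n.+1%:R `^ s.
    by rewrite -mulrA ler_pM2l// HK.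
  have Nn := leq_trans NK Kn; split; first exact: le_trans (bndx n Nn) le_mu.
  apply: (le_trans (bndy n Nn)); rewrite /mu' -[D * C * _ / _]mulrA -/kap [leRHS]mulrAC.
  by rewrite ler_wpM2r.
Qed.
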